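(* Let $\mu$ be an infinite ergodic $\mathcal{R}$-invariant measure on a stationary Bratteli diagram $B$ with incidence matrix $F$, defined by a non-distinguished eigenvalue $\lambda$ of the matrix $A=F^T$. Let $(x_1,\ldots,x_n)^T$ be the corresponding reduced vector and $H$ the additive subgroup of $\mathbb{R}$ generated by $\{x_1,\ldots,x_n\}$. Then the clopen values set $S(\mu)$ is group-like and $$S(\mu)=\left(\bigcup_{N=0}^\infty\frac{1}{\lambda^N}H\right)\cap[0,\infty).$$
   Context: Stationary Bratteli diagrams. Let $F=(f_{ij})$ be a $K\times K$ matrix of non-negative integers without zero rows or columns. The stationary Bratteli diagram $B$ with incidence matrix $F$ has levels $V_0=\{v_0\}$ and, for $k\ge1$, $V_k$ a copy of $\{1,\dots,K\}$; there is one edge from $v_0$ to each vertex of $V_1$ and, for $k\ge1$, $f_{ij}$ edges from vertex $j$ of $V_k$ to vertex $i$ of $V_{k+1}$. $X_B$ is the space of infinite paths starting at $v_0$, with topology generated by the (clopen) cylinder sets of paths with a prescribed initial segment; a cylinder set given by a path of length $N$ from $v_0$ to $i\in V_N$ is said to end in the vertex $i$ on level $N$. The tail (cofinal) equivalence relation $\mathcal{R}$ on $X_B$ relates two paths if they coincide from some level on; it is assumed aperiodic (all classes infinite). A measure is $\mathcal{R}$-invariant if for any two finite paths $e,e'$ from $v_0$ to the same vertex, replacing the initial segment $e$ by $e'$ preserves the measure (so cylinders ending in the same vertex of the same level have equal measure); it is ergodic if every $\mathcal{R}$-invariant Borel set is null or has null complement. Vertex classes are the strongly connected components of the directed graph on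 $\{1,\dots,K\}$ with $j\to i$ iff $f_{ij}>0$; $\beta\prec\alpha$ means $\beta\ne\alpha$ and there is a directed path from $\beta$ to $\alpha$. Put $A=F^T$, and let $A_\alpha$ be its restriction to $\alpha$; non-zero $A_\alpha$ are primitive (achieved by telescoping). $X_\alpha$ is the set of paths that eventually pass only through vertices of $\alpha$. The ergodic $\mathcal{R}$-invariant measures considered are the following: to a class $\alpha$ whose block has Perron–Frobenius eigenvalue $\lambda>1$ corresponds the $\mathcal{R}$-invariant measure $\mu$ (unique up to scaling) with $\mu(X_B\setminus X_\alpha)=0$ and measure $\xi_i/\lambda^{N-1}$ for each cylinder ending in $i\in\alpha$ on level $N$, where $A_\alpha\xi=\lambda\xi$, $\xi>0$. It is finite iff $\lambda$ exceeds the spectral radius of $A_\beta$ for all $\beta\prec\alpha$ ($\lambda$ distinguished), and infinite otherwise ($\lambda$ non-distinguished). Measures are considered only on their supports, so all vertices belong to $\alpha$ or to classes $\beta\prec\alpha$ and $\mu$ is full. For infinite $\mu$, let $B_f$ be the subdiagram whose vertices are those of $\alpha$ and of all $\beta\prec\alpha$ for which cylinders ending in $\beta$ have finite $\mu$-measure, with all edges of $B$ between them; number its vertices $1,\dots,n$. The reduced vector $x=(x_1,\dots,x_n)^T$ is the positive vector with $A_fx=\lambda x$ ($A_f$ the transpose of the incidence matrix of $B_f$), $\sum x_i=1$; $\mu$ is normalized so that each cylinder ending in vertex $i$ of $B_f$ on level $N$ has measure $x_i/\lambda^{N-1}$. $S(\mu)=\{\mu(U):U\text{ clopen in }X_B,\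 \mu(U)<\infty\}$. A dense countable unbounded subset $D\subset[0,\infty)$ is group-like if for every $\gamma\in D$ there is an additive subgroup $G\subset\mathbb{R}$ with $D\cap[0,\gamma]=G\cap[0,\gamma]$. *)

(* Defs.v *)
From HB Require Import structures.
From mathcomp Require Import all_boot all_order all_algebra.
From mathcomp Require Import all_classical all_reals all_analysis.
From mathcomp Require Import complex.

Set Implicit Arguments.
Unset Strict Implicit.
Unset Printing Implicit Defensive.

Import Order.TTheory GRing.Theory Num.Theory.
Import numFieldNormedType.Exports.

Local Open Scope classical_set_scope.
Local Open Scope ring_scope.

(* [B i j] is the number of edges from vertex [j] of a level [k >= 1] to     *)
(* vertex [i] of level [k.+1]; there are [K.+1 >= 1] vertices on each such   *)
(* level.                                                                    *)
Record bratteli (K : nat) := Bratteli {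
  incidence :> 'M[nat]_K.+1 ;
  no_zero_row : forall i, exists j, (0 < incidence i j)%N ;
  no_zero_col : forall j, exists i, (0 < incidence i j)%N }.

Section Paths.
Variables (K : nat) (B : bratteli K).

(* An edge is a pair (source, target) with one of the parallel edges.        *)
Definition edge := {ji : 'I_K.+1 * 'I_K.+1 & 'I_(B ji.2 ji.1)}.
Definition src (e : edge) : 'I_K.+1 := (tag e).1.
Definition tgt (e : edge) : 'I_K.+1 := (tag e).2.

HB.instance Definition _ := Finite.on edge.

(* A path starting at v_0 is given by its edges between the levels >= 1:     *)
(* there is a single edge from v_0 to each vertex of level 1, so the initial *)
(* edge is determined by [src (p 0)]. Thus [src (p k)] is the vertex of [p]  *)
(* on level [k.+1].                                                          *)
Record path_space := Path {
  path_edge :> nat -> edge ;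
  path_linked : forall k, tgt (path_edge k) = src (path_edge k.+1) }.

Definition out_vertex (j : 'I_K.+1) : 'I_K.+1 := xchoose (no_zero_col B j).

Definition out_edge (j : 'I_K.+1) : edge :=
  Tagged (fun ji : 'I_K.+1 * 'I_K.+1 => 'I_(B ji.2 ji.1))
    (Ordinal (xchooseP (no_zero_col B j)) : 'I_(B (j, out_vertex j).2 j)).

Definition some_path : path_space :=
  @Path (fun k => out_edge (iter k out_vertex ord0)) (fun k => erefl).

HB.instance Definition _ := gen_eqMixin path_space.
HB.instance Definition _ := gen_choiceMixin path_space.
HB.instance Definition _ := isPointed.Build path_space some_path.

Fixpoint composable (i : 'I_K.+1) (s : seq edge) : bool :=
  if s is e :: s' then (src e == i) && composable (tgt e) s' else true.

(* A finite path from v_0 of length [level e >= 1]: the edge from v_0 to the *)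
(* vertex [fstart e] of level 1 followed by the edges [fedges e].            *)
Record finite_path := FinitePath {
  fstart : 'I_K.+1 ;
  fedges : seq edge ;
  _ : composable fstart fedges }.

Definition level (e : finite_path) : nat := (size (fedges e)).+1.
Definition fend (e : finite_path) : 'I_K.+1 :=
  last (fstart e) [seq tgt f | f <- fedges e].

Definition cylinder (e : finite_path) : set path_space :=
  [set p : path_space | src (p 0%N) = fstart e /\
                        mkseq p (size (fedges e)) = fedges e].

HB.instance Definition _ :=
  isSubBaseTopological.Build path_space (range cylinder) id.

Local Notation borel_paths := (g_sigma_algebraType (@open path_space)).

Definition cofinal (p q : path_space) : Prop :=
  exists N, forall k, (N <= k)%N -> p k = q k.

Definition aperiodic : Prop :=
  forall p, infinite_set [set q | cofinal p q].

(* The image of [A `<=` cylinder e] when the initial segment [e] is replaced *)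
(* by [e'] (of the same level and ending in the same vertex).                *)
Definition replace_initial (e e' : finite_path) (A : set path_space) :
    set path_space :=
  [set q | cylinder e' q /\
    exists2 p, A p & forall k, (size (fedges e) <= k)%N -> q k = p k].

Definition eventually_in (alpha : {set 'I_K.+1}) : set path_space :=
  [set p | exists N, forall k, (N <= k)%N -> src (p k) \in alpha].

Definition adjacent : rel 'I_K.+1 := fun j i => (0 < B i j)%N.

Definition scc (i : 'I_K.+1) : {set 'I_K.+1} :=
  [set j | connect adjacent i j && connect adjacent j i]%SET.

Definition vertex_classes : {set {set 'I_K.+1}} := [set scc i | i : 'I_K.+1]%SET.

Definition prec (beta alpha : {set 'I_K.+1}) : bool :=
  (beta != alpha) &&
  [exists j in beta, exists i in alpha, connect adjacent j i].

Section Measures.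
Variable R : realType.

(* Restriction of the transpose of the incidence matrix to [D], the elements *)
(* of [D] being numbered by [enum_val].                                      *)
Definition block (D : {set 'I_K.+1}) : 'M[R]_#|D| :=
  let idx := @enum_val _ (mem D) in
  mxsub idx idx (map_mx (GRing.natmul 1) (incidence B)^T).

Variable mu : {measure set borel_paths -> \bar R}.

Definition tail_invariant : Prop :=
  forall e e' : finite_path, level e = level e' -> fend e = fend e' ->
  forall A : set borel_paths, measurable A -> A `<=` cylinder e ->
    mu (replace_initial e e' A) = mu A.

Definition saturated (A : set path_space) : Prop :=
  forall p q, cofinal p q -> A p -> A q.

Definition ergodic : Prop :=
  forall A : set borel_paths, measurable A -> saturated A ->
    mu A = 0%E \/ mu (~` A) = 0%E.

Definition class_measure (alpha : {set 'I_K.+1}) (lambda : R) : Prop :=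
  [/\ tail_invariant,
      mu (~` eventually_in alpha) = 0%E &
      exists xi : 'cV[R]_#|alpha|,
        [/\ forall i, 0 < xi i 0,
            block alpha *m xi = lambda *: xi &
            forall (e : finite_path) (i : 'I_#|alpha|), fend e = enum_val i ->
              mu (cylinder e) = (xi i 0 / lambda ^+ (level e).-1)%:E]].

Definition finite_cylinders (beta : {set 'I_K.+1}) : Prop :=
  forall e : finite_path, fend e \in beta -> (mu (cylinder e) < +oo)%E.

(* The vertices of the subdiagram B_f.                                       *)
Definition finite_vertices (alpha : {set 'I_K.+1}) : {set 'I_K.+1} :=
  (alpha :|: \bigcup_(beta in vertex_classes |
                prec beta alpha && `[< finite_cylinders beta >]) beta)%SET.

Definition clopen_values : set R :=
  [set fine (mu U) | U in [set U : set path_space |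
                            clopen U /\ (mu U < +oo)%E]].

End Measures.
End Paths.

Notation borel_paths B := (g_sigma_algebraType (@open (path_space B))).

Definition spectral_radius (R : realType) (n : nat) (M : 'M[R]_n) : R :=
  sup [set Normc.normc z |
        z in [set z | eigenvalue (map_mx (real_complex R) M) z]].

Definition primitive (R : realType) (n : nat) (M : 'M[R]_n) : Prop :=
  exists2 m, (0 < m)%N & forall i j, 0 < (M ^+ m) i j.

Definition distinguished (K : nat) (B : bratteli K) (R : realType)
    (alpha : {set 'I_K.+1}) (lambda : R) : Prop :=
  forall beta, beta \in vertex_classes B -> prec B beta alpha ->
    spectral_radius (block B R beta) < lambda.

Definition additive_subgroup (R : realType) (G : set R) : Prop :=
  zmod_closed (mem G).

Definition group_like (R : realType) (D : set R) : Prop :=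
  [/\ D `<=` `[0, +oo[, `[0, +oo[ `<=` closure D, countable D,
      ~ has_ubound D &
      forall gamma, D gamma -> exists2 G : set R, additive_subgroup G &
        D `&` `[0, gamma] = G `&` `[0, gamma]].

(* Main.v *)
Require Import Defs.
From mathcomp Require Import all_boot all_order all_algebra.
From mathcomp Require Import all_classical all_reals all_analysis.
From mathcomp Require Import finmap ring lra.

(** The measure of a clopen set of finite measure is a non-negative integer
    combination of the numbers [x_i / lambda^N], which gives one inclusion.
    Conversely let [r > 0] be [lambda^-N] times an integer combination of the
    [x_i]; [N] can be increased at will by applying the incidence matrix to the
    coefficients. If only vertices of the class [alpha] occur, then, [A_alpha]
    being primitive, the coefficients become non-negative at high levels, and so
    do those of [mu Y - r] for a clopen set [Y] of paths that are in [alpha] at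
    some level and have measure larger than [r]; hence [r] is the measure of a
    clopen subset of [Y]. The coefficients at the other vertices need not become
    positive, but since [lambda] is not an eigenvalue of the corresponding
    diagonal block, some integer [q > 0] maps every [x_i] into the group of
    [alpha]. These coefficients can therefore be reduced to values between [0]
    and [q - 1], for which enough disjoint cylinders exist by aperiodicity. *)

Set Implicit Arguments.
Unset Strict Implicit.
Unset Printing Implicit Defensive.

Import Order.TTheory GRing.Theory Num.Theory.
Import numFieldNormedType.Exports.

Local Open Scope classical_set_scope.
Local Open Scope ring_scope.

(** * Closure properties of additive subgroups of the reals *)

Section AdditiveSubgroup.
Variables (R : realType) (S : set R).
Hypothesis subS : additive_subgroup S.

Lemma subgroup0 : S 0.
Proof. by case: subS => /set_mem. Qed.

Lemma subgroupB a b : S a -> S b -> S (a - b).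
Proof.
case: subS => _ SB Sa Sb; apply/set_mem; apply: SB; exact: mem_set.
Qed.

Lemma subgroupN a : S a -> S (- a).
Proof. by move=> Sa; rewrite -[- a]sub0r; apply: subgroupB => //; exact: subgroup0. Qed.

Lemma subgroupD a b : S a -> S b -> S (a + b).
Proof. by move=> Sa Sb; rewrite -[b]opprK; apply: subgroupB => //; exact: subgroupN. Qed.

Lemma subgroupMz (z : int) a : S a -> S (z%:~R * a).
Proof.
move=> Sa; have Sn n : S (a *+ n).
  by elim: n => [|n IH]; rewrite ?mulrS; [exact: subgroup0|exact: subgroupD].
by case: z => n; rewrite mulrzl ?NegzE ?mulrNz -pmulrn //; exact: subgroupN.
Qed.

Lemma subgroup_sum (I : finType) (P : pred I) (F : I -> R) :
  (forall i, P i -> S (F i)) -> S (\sum_(i | P i) F i).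
Proof.
by move=> SF; elim/big_ind: _ => //; [exact: subgroup0|exact: subgroupD].
Qed.

End AdditiveSubgroup.

(** * Eventual positivity under positive and primitive matrices *)

Lemma pos_lower_bound (R : realType) (I : finType) (f : I -> R) :
  (forall i, 0 < f i) -> exists2 e : R, 0 < e & forall i, e <= f i.
Proof.
move=> f0; exists (\big[Order.min/1]_i f i).
  by apply: lt_bigmin => // i _; exact: f0.
by move=> i; apply: bigmin_le_cond.
Qed.

Lemma geometric_small (R : realType) (t b a : R) :
  0 <= t < 1 -> 0 < a -> exists k, t ^+ k * b <= a.
Proof.
move=> /andP[t0 t1] a0.
have : (fun k => b * t ^+ k) @ \oo --> (b * 0 : R).
  by apply: cvgMr; apply: cvg_expr; rewrite ger0_norm.
rewrite mulr0 => /cvgrPdist_le /(_ a a0)[k _ /(_ k (leqnn k))] /=.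
rewrite sub0r normrN => h; exists k; rewrite mulrC.
exact: le_trans (ler_norm _) h.
Qed.

(* Doeblin's argument: the total mass of [y], weighted by [x], grows exactly
   by [L] at each step, but the mass of its negative part only by
   [L * (1 - e)], because every entry receives a share [e] of the total mass. *)
Lemma positive_mx_eventually_ge0 (R : realType) n (P : 'M[R]_n) (L : R)
    (x : 'cV[R]_n) (y : 'rV[R]_n) :
  0 < L -> (forall i j, 0 < P i j) -> (forall i, 0 < x i 0) ->
  P *m x = L *: x -> 0 < (y *m x) 0 0 ->
  exists k, forall j, 0 <= (y *m (P ^+ k)) 0 j.
Proof.
move=> L0 P0 x0 Px.
(* [L * x i 0] is the weighted total of row [i]; each column receives at least the fraction [e] of
   it. *)
have [e e0 eP] : exists2 e : R, 0 < e & forall i j, e * (L * x i 0) <= P i j * x j 0.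
  have [|e e0 he] := @pos_lower_bound R _
      (fun ij : 'I_n * 'I_n => P ij.1 ij.2 * x ij.2 0 / (L * x ij.1 0)).
    by move=> [i j] /=; rewrite divr_gt0 ?mulr_gt0.
  exists e => // i j; have := he (i, j).
  by rewrite /= ler_pdivlMr ?mulr_gt0.
pose neg (z : 'rV[R]_n) i : R := Num.max (0 : R) (- z 0 i).
pose N z := \sum_i neg z i * x i 0.
pose s (z : 'rV[R]_n) := \sum_i z 0 i * x i 0.
have negge0 z i : 0 <= neg z i by rewrite le_max lexx.
have negle (z : 'rV_n) i : - z 0 i <= neg z i by rewrite le_max lexx orbT.
have Pxi i : \sum_j P i j * x j 0 = L * x i 0.
  by have /matrixP/(_ i 0) := Px; rewrite !mxE.
have Nge0 z : 0 <= N z.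
  by apply: sumr_ge0 => i _; rewrite mulr_ge0 // ltW.
have sS z : s (z *m P) = L * s z.
  rewrite /s; under eq_bigr do rewrite mxE mulr_suml.
  rewrite exchange_big /= mulr_sumr; apply: eq_bigr => i _.
  rewrite mulrCA -Pxi mulr_sumr; apply: eq_bigr => j _.
  by rewrite mulrA.
(* Sum over [i] of the nonnegative products of [z 0 i + neg z i] with
   [P i j * x j 0 - e * (L * x i 0)]. *)
have low (z : 'rV_n) j : 0 <= s z ->
    e * L * s z - \sum_i neg z i * (P i j * x j 0 - e * (L * x i 0))
    <= (z *m P) 0 j * x j 0.
  move=> sz; rewrite mxE mulr_suml /s mulr_sumr lerBlDr -big_split /=.
  apply: ler_sum => i _.
  have := eP i j; have := negle z i.
  move: (neg z i) (P i j) (x j 0) (x i 0) (z 0 i) => a b c d f h1 h2.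
  have : 0 <= (f + a) * (b * c - e * (L * d)) by rewrite mulr_ge0 //; lra.
  lra.
(* Summed over the columns, the weights of [neg z i] give [L * (1 - n * e) * x i 0], and [n > 0]
   bounds the factor by [1 - e]. *)
have Nstep z : 0 <= s z -> (0 < n)%N -> N (z *m P) <= L * (1 - e) * N z.
  move=> sz n0.
  apply: (@le_trans _ _ (\sum_j \sum_i neg z i * (P i j * x j 0 - e * (L * x i 0)))).
    apply: ler_sum => j _.
    have low' : - (z *m P) 0 j * x j 0
        <= \sum_i neg z i * (P i j * x j 0 - e * (L * x i 0)).
      have := low z j sz; have : 0 <= e * L * s z by rewrite !mulr_ge0 // ltW.
      lra.
    rewrite {1}/neg; case: (leP 0 (- _)) => _ //; rewrite mul0r.
    by apply: sumr_ge0 => i _; rewrite mulr_ge0 // subr_ge0.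
  rewrite exchange_big /= /N mulr_sumr; apply: ler_sum => i _.
  rewrite -mulr_sumr sumrB Pxi sumr_const card_ord.
  rewrite [leRHS]mulrCA; apply: ler_wpM2l => //.
  have : e * (L * x i 0) <= e * (L * x i 0) *+ n.
    by rewrite -[leLHS]mulr1n ler_pMn2l // !mulr_gt0.
  lra.
move=> sy; have {}sy : 0 < s y by move: sy; rewrite mxE.
have n0 : (0 < n)%N.
  case: (posnP n) => // nz; move: sy; rewrite /s big1 ?ltxx // => i _.
  by have := ltn_ord i; rewrite [X in (_ < X)%N]nz.
have PL i j : P i j * x j 0 <= L * x i 0.
  rewrite -Pxi (bigD1 j) //= lerDl sumr_ge0 // => k _.
  by rewrite mulr_ge0 // ltW.
have e1 : e <= 1.
  have i := Ordinal n0; have := le_trans (eP i i) (PL i i).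
  by rewrite -[leRHS]mul1r ler_pM2r // mulr_gt0.
have sk k : s (y *m P ^+ k) = L ^+ k * s y.
  elim: k => [|k IH]; first by rewrite expr0 mulmx1 mul1r.
  by rewrite exprSr mulmxA sS IH mulrA -exprS.
have sk0 k : 0 <= s (y *m P ^+ k) by rewrite sk mulr_ge0 ?exprn_ge0 // ltW.
have Nk k : N (y *m P ^+ k) <= L ^+ k * ((1 - e) ^+ k * N y).
  elim: k => [|k IH]; first by rewrite !expr0 mulmx1 !mul1r.
  rewrite exprSr mulmxA; apply: le_trans (Nstep _ (sk0 k) n0) _.
  rewrite (exprS L) (exprS (1 - e)).
  have Le0 : 0 <= L * (1 - e) by rewrite mulr_ge0 ?subr_ge0 // ltW.
  apply: le_trans (ler_wpM2l Le0 IH) _.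
  rewrite [leRHS](_ : _ = L * (1 - e) * (L ^+ k * ((1 - e) ^+ k * N y))) //.
  by ring.
have [|k hk] := @geometric_small R (1 - e) (N y) (e * s y) _ (mulr_gt0 e0 sy).
  by lra.
(* After [k] steps the negative mass is at most [e] times the total; in one more step every entry
   receives a share that outweighs it. *)
exists k.+1 => j; rewrite exprSr mulmxA.
rewrite -(pmulr_lge0 _ (x0 j)); apply: le_trans (low _ j (sk0 k)).
have : \sum_i neg (y *m P ^+ k) i * (P i j * x j 0 - e * (L * x i 0))
       <= L * N (y *m P ^+ k).
  rewrite /N mulr_sumr; apply: ler_sum => i _.
  rewrite [leRHS]mulrCA; apply: ler_wpM2l => //.
  have := PL i j; have : 0 < e * (L * x i 0) by rewrite !mulr_gt0.
  lra.
have := ler_wpM2l (ltW L0) (Nk k).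
have := ler_wpM2l (ltW L0) (ler_wpM2l (exprn_ge0 k (ltW L0)) hk).
rewrite sk; lra.
Qed.

Lemma primitive_mx_eventually_ge0 (R : realType) n (A : 'M[R]_n) (lambda : R)
    (x : 'cV[R]_n) (y : 'rV[R]_n) :
  0 < lambda -> primitive A -> (forall i, 0 < x i 0) ->
  A *m x = lambda *: x -> 0 < (y *m x) 0 0 ->
  exists k, forall j, 0 <= (y *m (A ^+ k)) 0 j.
Proof.
move=> l0 [m m0 Am] x0 Ax yx.
have Akx k : A ^+ k *m x = lambda ^+ k *: x.
  elim: k => [|k IH]; first by rewrite !expr0 mul1mx scale1r.
  by rewrite exprSr -mulmxA Ax -scalemxAr IH scalerA -exprS.
have [k hk] := positive_mx_eventually_ge0 (exprn_gt0 m l0) Am x0 (Akx m) yx.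
by exists (m * k)%N; rewrite exprM.
Qed.

(** * Arithmetic of an algebraic eigenvalue *)

(** A rational polynomial [d] of least degree vanishing at [lambda] is coprime to [p], so Bezout's
    identity evaluated at [lambda] inverts [p(lambda)]; clearing denominators leaves the integer
    [q]. *)
Lemma algebraic_integer_multiple (R : realType) (lambda : R)
    (c : {poly rat}) (p : {poly int}) :
  c != 0 -> root (map_poly ratr c) lambda ->
  (map_poly intr p).[lambda] != 0 ->
  exists (u : {poly int}) (q : nat), (0 < q)%N /\
    q%:R = (map_poly intr u).[lambda] * (map_poly intr p).[lambda].
Proof.
move=> c0 cl pl.
pose Q n := `[< exists d : {poly rat},
  [/\ d != 0, root (map_poly ratr d) lambda & size d = n] >].
have [|n /asboolP[d [d0 dl sd]] dmin] := @ex_minnP Q.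
  by exists (size c); apply/asboolP; exists c.
pose pQ : {poly rat} := map_poly intr p.
have evQ (r : {poly int}) :
    (map_poly ratr (map_poly intr r : {poly rat})).[lambda]
    = (map_poly intr r).[lambda].
  rewrite -map_poly_comp; congr (_.[_]); apply: eq_map_poly => z /=.
  by rewrite ratr_int.
(* The gcd cannot vanish at [lambda], since [p] does not; so its cofactor in [d] does, and
   minimality of [d] makes the gcd constant. *)
have cop : coprimep d pQ.
  have g0 : gcdp d pQ != 0 by rewrite gcdp_eq0 negb_and d0.
  have dE := divpK (dvdp_gcdl d pQ).
  have gl : ~~ root (map_poly ratr (gcdp d pQ)) lambda.
    apply: contra pl => gl; rewrite -evQ -/pQ -(divpK (dvdp_gcdr d pQ)).
    by rewrite rmorphM hornerM (rootP gl) mulr0.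
  have el : root (map_poly ratr (d %/ gcdp d pQ)) lambda.
    by move: dl; rewrite -{1}dE rmorphM rootM (negPf gl) orbF.
  have e0 : d %/ gcdp d pQ != 0.
    by apply: contraNneq d0 => e0; rewrite -dE e0 mul0r.
  have := dmin (size (d %/ gcdp d pQ)).
  rewrite /coprimep size_divp // sd => h.
  have {h} : (n <= n - (size (gcdp d pQ)).-1)%N.
    by apply: h; apply/asboolP; exists (d %/ gcdp d pQ); rewrite size_divp // sd.
  have : (0 < n)%N by rewrite -sd size_poly_gt0.
  by move: g0; rewrite -size_poly_gt0; case: (size (gcdp d pQ)) => [|[|k]] // _ n0;
    rewrite leqNgt ltn_subrL n0.
have /Bezout_eq1_coprimepP[[u v] /= uv] := cop.
have [w [a a0 vE]] := rat_poly_scale v.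
have wp : (map_poly intr w).[lambda] * (map_poly intr p).[lambda] = a%:~R.
  have : (map_poly ratr (u * d + v * pQ)).[lambda] = 1.
    by rewrite uv rmorph1 hornerC.
  rewrite rmorphD !rmorphM hornerD !hornerM (rootP dl) mulr0 add0r evQ vE.
rewrite /= map_polyZ hornerZ evQ fmorphV /= ratr_int => h.
  have a0' : (a%:~R : R) != 0 by rewrite intr_eq0.
  by apply: (mulfI (invr_neq0 a0')); rewrite mulVf // mulrA.
(* The denominator [a] may be negative; then [- w] is used. *)
case: a a0 wp {vE} => a a0 wp.
  by exists w, a; rewrite wp; split=> //; rewrite lt0n.
exists (- w), a.+1; split=> //.
by rewrite rmorphN hornerN mulNr wp NegzE mulrNz opprK.
Qed.

(** For [v] in the left kernel, [|v|] satisfies [lambda |v| <= |v| A]. Pairing with [x] turns this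
    into a vanishing sum of nonnegative terms, so equality holds and [v] is zero wherever
    [lambda x - A x] is positive. The zero set of [v] then meets the conditions on [Z]. *)
Lemma det_scalar_sub_neq0 (R : realType) d (A : 'M[R]_d) (lambda : R) (x : 'cV[R]_d) :
  0 < lambda -> (forall i j, 0 <= A i j) -> (forall i, 0 < x i 0) ->
  (forall i, 0 <= (lambda *: x - A *m x) i 0) ->
  (forall Z : set 'I_d, (forall i, 0 < (lambda *: x - A *m x) i 0 -> Z i) ->
     (forall i j, 0 < A i j -> Z j -> Z i) -> Z = setT) ->
  \det (lambda%:M - A) != 0.
Proof.
move=> l0 A0 x0 g0 conn; apply/negP => /det0P[v v0 vA].
have {}vA j : \sum_i v 0 i * A i j = lambda * v 0 j.
  have /matrixP/(_ 0 j) := vA; rewrite mulmxBr mul_mx_scalar !mxE => /eqP.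
  by rewrite subr_eq0 => /eqP.
pose g i := (lambda *: x - A *m x) i 0.
have gE i : \sum_j A i j * x j 0 = lambda * x i 0 - g i.
  by rewrite /g !mxE opprB addrCA subrr addr0.
have vle j : lambda * `|v 0 j| <= \sum_i `|v 0 i| * A i j.
  rewrite -{1}(gtr0_norm l0) -normrM -vA (le_trans (ler_norm_sum _ _ _)) //.
  by apply: ler_sum => i _; rewrite normrM (ger0_norm (A0 i j)).
have tot : \sum_j (\sum_i `|v 0 i| * A i j - lambda * `|v 0 j|) * x j 0
    + \sum_i `|v 0 i| * g i = 0.
  under eq_bigr do rewrite mulrBl mulr_suml.
  rewrite sumrB exchange_big /= -addrAC -big_split /= -sumrB big1 // => i _.
  under eq_bigr do rewrite -mulrA.
  by rewrite -mulr_sumr gE; ring.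
have t1 j : 0 <= (\sum_i `|v 0 i| * A i j - lambda * `|v 0 j|) * x j 0.
  by rewrite mulr_ge0 ?subr_ge0 // ltW.
have t2 i : 0 <= `|v 0 i| * g i by rewrite mulr_ge0 // g0.
move/eqP: tot; rewrite paddr_eq0 ?sumr_ge0 //.
rewrite !psumr_eq0 // => /andP[/allP h1 /allP h2].
have ZT : [set i | v 0 i = 0] = setT.
  apply: conn => [i gi|i j Aij /= vj].
    have := h2 i (mem_index_enum i); rewrite mulf_eq0 normr_eq0.
    by case/orP=> /eqP // h; move: gi; rewrite -/(g i) h ltxx.
  have := h1 j (mem_index_enum j).
  rewrite mulf_eq0 (gt_eqF (x0 j)) orbF vj normr0 mulr0 subr0.
  rewrite psumr_eq0; last by move=> k _; rewrite mulr_ge0.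
  move/allP/(_ i (mem_index_enum i)).
  by rewrite mulf_eq0 (gt_eqF Aij) orbF normr_eq0 => /eqP.
move/negP: v0; apply; apply/eqP/rowP => i; rewrite mxE.
by have : [set i | v 0 i = 0] i by rewrite ZT.
Qed.

(** Let [chi] be the characteristic polynomial of [A]. The adjugate of [lambda - A] has integer
    polynomials in [lambda] as entries; applied to [lambda x - A x] it puts [chi(lambda) x] into
    [S]. Some integer polynomial in [lambda] times [chi(lambda)] is a positive integer. *)
Lemma integer_multiple_mem (R : realType) d (A : 'M[int]_d) (lambda : R)
    (x : 'cV[R]_d) (c : {poly rat}) (S : set R) :
  additive_subgroup S -> (forall s, S s -> S (lambda * s)) ->
  c != 0 -> root (map_poly ratr c) lambda ->
  \det (lambda%:M - map_mx intr A) != 0 ->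
  (forall i, S ((lambda *: x - map_mx intr A *m x) i 0)) ->
  exists2 q : nat, (0 < q)%N & forall i, S (q%:R * x i 0).
Proof.
move=> subS Sl c0 cl det0 Sg.
pose ev := horner_eval lambda \o map_poly (intr : int -> R).
have Sev p a : S a -> S (ev p * a).
  move=> Sa; elim/poly_ind: p => [|p z IH].
    by rewrite /ev /= rmorph0 /horner_eval horner0 mul0r; exact: subgroup0.
  rewrite /ev /= rmorphD rmorphM /= map_polyX map_polyC /horner_eval.
  rewrite hornerMXaddC mulrDl; apply: subgroupD => //; last exact: subgroupMz.
  by rewrite mulrAC mulrC; exact: Sl.
have evM : map_mx ev (char_poly_mx A) = lambda%:M - map_mx intr A.
  apply/matrixP => i j; rewrite !mxE /ev /= rmorphB rmorphMn /= map_polyX map_polyC.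
  by rewrite /horner_eval hornerD hornerN hornerC hornerMn hornerX.
have evdet : ev (char_poly A) = \det (lambda%:M - map_mx intr A).
  by rewrite -evM det_map_mx.
have detx i : S (ev (char_poly A) * x i 0).
  have -> : ev (char_poly A) * x i 0
      = \sum_j ev (\adj (char_poly_mx A) i j)
          * (lambda *: x - map_mx intr A *m x) j 0.
    have -> : lambda *: x - map_mx intr A *m x = (lambda%:M - map_mx intr A) *m x.
      by rewrite mulmxBl mul_scalar_mx.
    transitivity ((\adj (lambda%:M - map_mx intr A) *m
        ((lambda%:M - map_mx intr A) *m x)) i 0).
      by rewrite mulmxA mul_adj_mx mul_scalar_mx mxE evdet.
    rewrite mxE; apply: eq_bigr => j _.
    by rewrite -evM -map_mx_adj mxE.
  by apply: subgroup_sum => // j _; exact: Sev.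
have [|u [q [q0 qE]]] := @algebraic_integer_multiple R lambda c (char_poly A) c0 cl.
  by move: det0; rewrite -evdet.
exists q => // i; rewrite qE -mulrA; exact: Sev (detx i).
Qed.

(** * Finite paths and the numbers of their ends *)

Section FinitePaths.
Variables (K : nat) (B : bratteli K).

(** A finite path is kept as a bare pair, with composability a separate boolean in [is_node], so
    that lists of paths can be filtered and counted. A node with [m] edges ends on level [m.+1]. *)
Local Notation node := ('I_K.+1 * seq (edge B))%type.

Definition node_end (t : node) : 'I_K.+1 := last t.1 [seq tgt f | f <- t.2].

Definition is_node (m : nat) (t : node) := composable t.1 t.2 && (size t.2 == m).

Definition prefix_node (m : nat) (p : path_space B) : node := (src (p 0%N), mkseq p m).

Definition extensions (l : seq node) : seq node :=
  [seq (t.1, rcons t.2 f) |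
    t <- l, f <- [seq f <- enum {: edge B} | src f == node_end t]].

Definition all_nodes (m : nat) : seq node :=
  iter m extensions [seq (i, [::]) | i <- enum 'I_K.+1].

Definition count_end (l : seq node) (i : 'I_K.+1) : nat :=
  count (fun t => node_end t == i) l.

Definition paths_through (m : nat) (l : seq node) : set (path_space B) :=
  [set p | prefix_node m p \in l].

Lemma composable_rcons i (s : seq (edge B)) f :
  composable i (rcons s f) = composable i s && (src f == node_end (i, s)).
Proof.
rewrite /node_end; elim: s i => [|e s IH] i /=; first by rewrite andbT.
by rewrite IH andbA.
Qed.

Lemma prefix_nodeS m p :
  prefix_node m.+1 p = ((prefix_node m p).1, rcons (prefix_node m p).2 (p m)).
Proof. by rewrite /prefix_node /= mkseqS. Qed.

Lemma node_end_prefix m p : node_end (prefix_node m p) = src (p m).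
Proof.
case: m => [//|m].
by rewrite /node_end prefix_nodeS /= map_rcons last_rcons; exact: path_linked.
Qed.

Lemma prefix_is_node m p : is_node m (prefix_node m p).
Proof.
rewrite /is_node size_mkseq eqxx andbT; elim: m => [//|m IH].
by rewrite prefix_nodeS composable_rcons IH (node_end_prefix m p) eqxx.
Qed.

Lemma is_node_rcons m i s (f : edge B) :
  is_node m.+1 (i, rcons s f) = is_node m (i, s) && (src f == node_end (i, s)).
Proof. by rewrite /is_node composable_rcons size_rcons eqSS andbAC. Qed.

Lemma is_nodeSP m t : is_node m.+1 t ->
  exists i s f, [/\ t = (i, rcons s f), is_node m (i, s) & src f = node_end (i, s)].
Proof.
case: t => i s; case/lastP: s => [|s f]; first by rewrite /is_node andbF.
by rewrite is_node_rcons => /andP[h /eqP e]; exists i, s, f.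
Qed.

Lemma mem_extensions l i s f :
  ((i, rcons s f) \in extensions l) = ((i, s) \in l) && (src f == node_end (i, s)).
Proof.
apply/allpairsPdep/andP => [[[i' s'] [f' [tl]]]|[tl /eqP fe]]; last first.
  by exists (i, s), f; rewrite mem_filter fe eqxx mem_enum.
rewrite mem_filter /= => /andP[fe _] [-> /eqP].
by rewrite eqseq_rcons => /andP[/eqP -> /eqP ->].
Qed.

Lemma extensions_uniq l : uniq l -> uniq (extensions l).
Proof.
move=> ul; apply: allpairs_uniq_dep => // [t _|].
  by rewrite filter_uniq // enum_uniq.
move=> [[i s] f] [[i' s'] f'] _ _ /= [-> /eqP].
by rewrite eqseq_rcons => /andP[/eqP -> /eqP ->].
Qed.

Lemma extensions_nodes m l :
  {in l, forall t, is_node m t} -> {in extensions l, forall t, is_node m.+1 t}.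
Proof.
move=> hl _ /allpairsPdep[[i s] [f [tl + ->]]].
by rewrite mem_filter is_node_rcons (hl _ tl) /= => /andP[].
Qed.

Lemma paths_through_extensions m l :
  paths_through m.+1 (extensions l) = paths_through m l.
Proof.
apply/seteqP; split=> p; rewrite /paths_through /= prefix_nodeS mem_extensions.
  by case/andP.
by rewrite -surjective_pairing node_end_prefix eqxx andbT.
Qed.

Lemma card_edges (j i : 'I_K.+1) :
  count (fun f : edge B => (src f == j) && (tgt f == i)) (enum {: edge B}) = B i j.
Proof.
pose h (k : 'I_(B i j)) : edge B :=
  Tagged (fun ji : 'I_K.+1 * 'I_K.+1 => 'I_(B ji.2 ji.1)) (k : 'I_(B (j, i).2 (j, i).1)).
have hinj : injective h by move=> k k' /eqP; rewrite eq_Tagged => /eqP.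
rewrite -[RHS]card_ord -(card_codom hinj) -size_filter cardE.
apply: perm_size; apply: uniq_perm => [||f].
- by apply: filter_uniq; exact: enum_uniq.
- exact: enum_uniq.
rewrite mem_filter !mem_enum andbT; apply/andP/codomP => [[]|[k ->]] //.
case: f => -[j' i'] k; rewrite /src /tgt /= => /eqP jj /eqP ii.
by subst j' i'; exists k.
Qed.

(** Each path ending in [j] has [B i j] prolongations to [i]; this makes path counting follow the
    incidence matrix. *)
Lemma count_end_extensions l i :
  count_end (extensions l) i = (\sum_j B i j * count_end l j)%N.
Proof.
rewrite /count_end /extensions count_flatten -!map_comp sumnE big_map.
transitivity (\sum_(t <- l) B i (node_end t))%N.
  apply: eq_bigr => t _; rewrite /= count_map count_filter -card_edges.
  apply: eq_count => f /=.
  by rewrite /node_end map_rcons last_rcons andbC.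
transitivity (\sum_(t <- l) \sum_j (B i j * (node_end t == j)))%N.
  apply: eq_bigr => t _; rewrite (bigD1 (node_end t)) //= eqxx muln1 big1 ?addn0 //.
  by move=> j /negPf; rewrite eq_sym => ->; rewrite muln0.
rewrite exchange_big /=; apply: eq_bigr => j _.
by rewrite -big_distrr /= -sum1_count [in RHS]big_mkcond.
Qed.

Lemma all_nodes_uniq m : uniq (all_nodes m).
Proof.
elim: m => [|m IH]; last exact: extensions_uniq.
by rewrite /all_nodes /= map_inj_uniq ?enum_uniq // => i j [].
Qed.

Lemma mem_all_nodes m t : (t \in all_nodes m) = is_node m t.
Proof.
elim: m t => [|m IH] [i s].
  rewrite /all_nodes /= /is_node; case: s => [|f s] /=; last first.
    by rewrite andbF; apply/mapP => -[].
  by apply/mapP; exists i; rewrite ?mem_enum.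
case/lastP: s => [|s f]; last by rewrite mem_extensions IH is_node_rcons.
rewrite /is_node /=; apply/allpairsPdep => -[t' [f [_ _ []]]].
by case: t'.2.
Qed.

Lemma count_end_gt0 m i : (0 < count_end (all_nodes m) i)%N.
Proof.
elim: m i => [|m IH] i.
  rewrite /count_end -has_count; apply/hasP; exists (i, [::]) => //=.
  by apply/mapP; exists i; rewrite ?mem_enum.
have [j Bj] := no_zero_row B i.
by rewrite count_end_extensions (bigD1 j) //= addn_gt0 muln_gt0 Bj IH.
Qed.

(** Serves to pick cylinders with prescribed numbers of ends: a greedy pass keeps an element while
    its demand is positive. *)
Lemma subseq_count (T : eqType) (I : eqType) (h : T -> I) (l : seq T) (w : I -> nat) :
  (forall i, w i <= count (fun t => h t == i) l)%N ->
  exists2 l', subseq l' l & forall i, count (fun t => h t == i) l' = w i.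
Proof.
elim: l w => [|t l IH] w hw.
  by exists [::] => // i; have := hw i; rewrite leqn0 => /eqP ->.
case: (posnP (w (h t))) => wt.
  have [i|l' sl cl] := IH w.
    by have := hw i; rewrite /=; case: eqP => // <-; rewrite wt.
  by exists l' => //; exact: subseq_trans sl (subseq_cons _ _).
have [i|l' sl cl] := IH (fun i => (w i - (h t == i))%N).
  by have := hw i; rewrite /= leq_subLR.
exists (t :: l') => [|i]; first by rewrite /= eqxx.
by rewrite /= cl; case: eqP => [<-|_]; rewrite ?subn0 // subnKC.
Qed.

(* König's lemma: [Q i s] says that [s] can be continued to arbitrary length
   inside [P]; since there are finitely many edges, [Q] can be prolonged. *)
Lemma konig (P : node -> Prop) :
  (forall i s f, P (i, rcons s f) -> P (i, s)) ->
  (forall m, exists2 t, is_node m t & P t) ->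
  exists p, forall m, P (prefix_node m p).
Proof.
move=> Pr Pm.
pose Q (t : node) := forall m, (size t.2 <= m)%N ->
  exists s, [/\ is_node m (t.1, s), P (t.1, s) & prefix t.2 s].
have Qpre (t : node) s' m : is_node m.+1 (t.1, s') -> P (t.1, s') ->
    prefix t.2 s' -> (size t.2 <= m)%N ->
    exists s, [/\ is_node m (t.1, s), P (t.1, s) & prefix t.2 s].
  move=> /is_nodeSP[i [s [f [[-> ->] ns _]]]] /Pr Ps /prefixP[s1 se] tm.
  exists s; split=> //.
  have sz : size s = m by move: ns => /andP[_ /eqP].
  have -> : s = take m (t.2 ++ s1) by rewrite -se -cats1 take_size_cat.
  by rewrite take_cat ltnNge tm /= prefix_prefix.
have down (t : node) m m' : (size t.2 <= m <= m')%N ->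
    (exists s, [/\ is_node m' (t.1, s), P (t.1, s) & prefix t.2 s]) ->
    exists s, [/\ is_node m (t.1, s), P (t.1, s) & prefix t.2 s].
  move=> /andP[tm mm']; rewrite -(subnKC mm'); elim: (_ - _)%N => [|k IH].
    by rewrite addn0.
  rewrite addnS => -[s [h1 h2 h3]]; apply: IH.
  by apply: Qpre h1 h2 h3 _; exact: leq_trans tm (leq_addr _ _).
have notQ t : ~ Q t -> exists m, forall m', (m <= m')%N ->
    ~ exists s, [/\ is_node m' (t.1, s), P (t.1, s) & prefix t.2 s].
  move=> /existsNP[m] /not_implyP[tm ns]; exists m => m' mm' h; apply: ns.
  by apply: down h; rewrite tm.
(* If no start vertex were good, a path in [P] whose length is the maximum of the bounds [g i] would
   contradict the bound of its own start. *)
have [i0 Qi0] : exists i, Q (i, [::]).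
  apply: contrapT => /forallNP nQ.
  have /choice[g hg] : forall i, exists m, forall m', (m <= m')%N ->
      ~ exists s, [/\ is_node m' (i, s), P (i, s) & prefix [::] s].
    by move=> i; have := notQ _ (nQ i).
  have [[i s] nt Pt] := Pm (\max_i g i).
  apply: (hg i (\max_i g i) (leq_bigmax _)); exists s; split=> //.
  exact: prefix0s.
have Qstep t : Q t -> exists f, Q (t.1, rcons t.2 f).
  move=> Qt; apply: contrapT => /forallNP nQ.
  have /choice[g hg] : forall f, exists m, forall m', (m <= m')%N ->
      ~ exists s, [/\ is_node m' (t.1, s), P (t.1, s) & prefix (rcons t.2 f) s].
    by move=> f; have := notQ _ (nQ f).
  (* The first argument of [maxn] forces [s] to be strictly longer than [t.2], so that it has a next
     edge. *)
  pose M := maxn (size t.2).+1 (\max_f g f).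
  have [s [h1 h2 /prefixP[s' se]]] := Qt M (leq_trans (leqnSn _) (leq_maxl _ _)).
  case: s' se => [|f s'] se.
    move: h1; rewrite /is_node se cats0 => /andP[_ /eqP sz].
    by have := leq_maxl (size t.2).+1 (\max_f g f); rewrite -/M -sz ltnn.
  apply: (hg f M (leq_trans (leq_bigmax _) (leq_maxr _ _))); exists s; split=> //.
  by rewrite se -cat_rcons prefix_prefix.
have f0 : edge B := some_path B 0%N.
have /choice[g hg] : forall t, exists f, Q t -> Q (t.1, rcons t.2 f).
  by move=> t; have [/Qstep[f ?]|?] := pselect (Q t); [exists f|exists f0].
pose s_ := fix s_ m := if m is m'.+1 then rcons (s_ m') (g (i0, s_ m')) else [::].
have Qs m : Q (i0, s_ m) by elim: m => //= m IH; exact: (hg (i0, s_ m)).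
have sz m : size (s_ m) = m by elim: m => //= m IH; rewrite size_rcons IH.
have sP m : is_node m (i0, s_ m) /\ P (i0, s_ m).
  (* At its own length the continuation granted by [Q] is [s_ m] itself, which therefore lies in
     [P]. *)
  have := Qs m m; rewrite /= sz => /(_ (leqnn _))[s [h1 h2 /prefixP[s' e]]].
  suff -> : s_ m = s by [].
  move: h1 => /andP[_ /eqP /=]; rewrite e size_cat sz => /eqP.
  by rewrite -[X in _ == X]addn0 eqn_add2l => /nilP ->; rewrite cats0.
pose p m := g (i0, s_ m).
have psrc m : src (p m) = node_end (i0, s_ m).
  by have [+ _] := sP m.+1; rewrite /= is_node_rcons => /andP[_ /eqP].
have pl m : tgt (p m) = src (p m.+1).
  by rewrite psrc /node_end /= map_rcons last_rcons.
exists (Path pl) => m.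
have -> : prefix_node m (Path pl) = (i0, s_ m); last by have [] := sP m.
rewrite /prefix_node /= psrc; congr pair.
by elim: m => //= m IH; rewrite mkseqS IH.
Qed.

End FinitePaths.

(** * Topology of the path space *)

Section PathSpace.
Variables (K : nat) (B : bratteli K).

Local Notation node := ('I_K.+1 * seq (edge B))%type.

Lemma path_eq (p q : path_space B) : p =1 q -> p = q.
Proof.
case: p q => [p hp] [q hq] /= /funext pq; subst q.
by congr Path; exact: Prop_irrelevance.
Qed.

Lemma prefix_node_eq (m : nat) (p q : path_space B) :
  prefix_node m p = prefix_node m q -> forall k, (k < m)%N -> p k = q k.
Proof.
move=> [_ e] k km; have := congr1 (fun s => nth (p 0%N) s k) e.
by rewrite !nth_mkseq.
Qed.

Lemma prefix_node_le (m m' : nat) (p q : path_space B) : (m <= m')%N ->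
  prefix_node m' p = prefix_node m' q -> prefix_node m p = prefix_node m q.
Proof.
move=> mm' e; congr pair; first by case: e.
apply: (@eq_from_nth _ (p 0%N)); rewrite !size_mkseq // => k km.
by rewrite !nth_mkseq // (prefix_node_eq e) // (leq_trans km).
Qed.

Lemma prefix_node_rcons (m : nat) (p : path_space B) i s f :
  prefix_node m.+1 p = (i, rcons s f) -> prefix_node m p = (i, s).
Proof.
rewrite prefix_nodeS => -[e /eqP]; rewrite eqseq_rcons => /andP[/eqP e' _].
exact: injective_projections.
Qed.

Lemma cylinder_paths_through (e : finite_path B) :
  cylinder e = paths_through (size (fedges e)) [:: (fstart e, fedges e)].
Proof.
apply/seteqP; split=> p; rewrite /paths_through /= inE.
  by case=> h1 h2; rewrite /prefix_node h1 h2.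
by move=> /eqP[].
Qed.

Lemma open_cylinder (e : finite_path B) : open (cylinder e).
Proof.
exists [set cylinder e]; last by rewrite bigcup_set1.
by move=> _ ->; apply: (@finI_from1 _ _ _ id); exists e.
Qed.

Lemma paths_through_cons (m : nat) (t : node) l :
  paths_through m (t :: l) = paths_through m [:: t] `|` paths_through m l.
Proof.
apply/seteqP; split=> p; rewrite /paths_through /= !inE.
  by case/orP; [left|right].
by case=> ->; rewrite ?orbT.
Qed.

Lemma paths_through1 (m : nat) (t : node) : is_node m t ->
  exists e : finite_path B, [/\ fstart e = t.1, fedges e = t.2, size (fedges e) = m &
    paths_through m [:: t] = cylinder e].
Proof.
move=> /andP[tc /eqP tm]; exists (FinitePath tc); split=> //.
by rewrite cylinder_paths_through /= tm -surjective_pairing.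
Qed.

Lemma paths_through_not_node (m : nat) (t : node) : ~~ is_node m t ->
  paths_through m [:: t] = set0.
Proof.
move=> tm; rewrite -subset0 => p; rewrite /paths_through /= inE => /eqP e.
by move: tm; rewrite -e prefix_is_node.
Qed.

Lemma open_paths_through (m : nat) (l : seq node) : open (paths_through m l).
Proof.
elim: l => [|t l IH].
  rewrite (_ : paths_through _ _ = set0); first exact: open0.
  by rewrite -subset0.
rewrite paths_through_cons; apply: openU => //.
have [/paths_through1[e [_ _ _ ->]]|/paths_through_not_node ->] := boolP (is_node m t).
  exact: open_cylinder.
exact: open0.
Qed.

Lemma paths_throughC (m : nat) (l : seq node) :
  ~` paths_through m l = paths_through m [seq t <- all_nodes B m | t \notin l].
Proof.
apply/seteqP; split=> p; rewrite /paths_through /= mem_filter mem_all_nodes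
  prefix_is_node andbT; first by move/negP.
exact: negP.
Qed.

Lemma clopen_paths_through (m : nat) (l : seq node) : clopen (paths_through m l).
Proof.
split; first exact: open_paths_through.
by rewrite -openC paths_throughC; exact: open_paths_through.
Qed.

(** Around [p] the set contains a finite intersection of cylinders, and the longest prefix occurring
    in it suffices. *)
Lemma open_prefix (U : set (path_space B)) p : open U -> U p ->
  exists m, forall q, prefix_node m q = prefix_node m p -> U q.
Proof.
move=> [D' D'sub <-] [V D'V Vp]; have [F Fsub FV] :
  finI_from (range (@cylinder K B)) id V := D'sub _ D'V.
have {}Vp : (\bigcap_(A in [set` F]) A) p by rewrite FV.
suff [m hm] : exists m, forall q, prefix_node m q = prefix_node m p ->
    (\bigcap_(A in [set` F]) A) q.
  by exists m => q /hm Uq; exists V => //; rewrite -FV.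
have /choice[g hg] : forall A : set (path_space B), exists m, A \in F ->
    forall q, prefix_node m q = prefix_node m p -> A q.
  move=> A; have [AF|AF] := boolP (A \in F); last by exists 0%N.
  have [e _ eA] := set_mem (Fsub _ AF); exists (size (fedges e)) => _ q.
  have : A p by exact: Vp.
  rewrite -eA cylinder_paths_through /paths_through /= !inE => /eqP <- ->.
  exact: eqxx.
exists (\max_(A <- F) g A)%N => q hq A AF.
apply: (hg A AF); apply: prefix_node_le hq.
exact: leq_bigmax_seq.
Qed.

(** Compactness in the form of König's lemma: if no level decided [U], some path would have all its
    prefixes shared by points inside and outside [U], against openness of [U] or of its
    complement. *)
Lemma clopenP (U : set (path_space B)) : clopen U ->
  exists m l, [/\ uniq l, {in l, forall t, is_node m t} & U = paths_through m l].
Proof.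
move=> [oU cU]; have oCU : open (~` U) by rewrite openC.
have [m hm] : exists m, forall p q, prefix_node m p = prefix_node m q -> U p -> U q.
  apply: contrapT => /forallNP nU.
  pose P (t : node) := exists p q, [/\ prefix_node (size t.2) p = t,
    prefix_node (size t.2) q = t, U p & ~ U q].
  have [i s f [p [q [hp hq Up nUq]]]|m|p hp] := @konig _ B P.
  - exists p, q; split=> //=.
      by apply: prefix_node_rcons; rewrite -(size_rcons s f); exact: hp.
    by apply: prefix_node_rcons; rewrite -(size_rcons s f); exact: hq.
  - have := nU m => /existsNP[p] /existsNP[q] /not_implyP[pq] /not_implyP[Up nUq].
    exists (prefix_node m p); first exact: prefix_is_node.
    by exists p, q; rewrite /= size_mkseq -pq.
  - have [Up|nUp] := pselect (U p).
      have [m hm] := open_prefix oU Up.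
      have [_ [q [_ hq _ nUq]]] := hp m.
      by apply: nUq; apply: hm; move: hq; rewrite /= size_mkseq.
    have [m hm] := open_prefix oCU nUp.
    have [q [_ [hq _ Uq _]]] := hp m.
    by apply: (hm q) => //; move: hq; rewrite /= size_mkseq.
exists m, [seq t <- all_nodes B m | `[< exists2 p, prefix_node m p = t & U p >]].
split.
- by rewrite filter_uniq // all_nodes_uniq.
- by move=> t; rewrite mem_filter mem_all_nodes => /andP[].
apply/seteqP; split=> p; rewrite /paths_through /= mem_filter mem_all_nodes
    prefix_is_node andbT.
  by move=> Up; apply/asboolP; exists p.
by move=> /asboolP[q qp Uq]; exact: hm Uq.
Qed.

(** Otherwise König's lemma gives a path [p] each of whose vertices is reached by fewer than [C]
    finite paths. But [C] members of the infinite cofinal class of [p], once all merged with it,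
    have [C] distinct initial segments with the same end. *)
Lemma aperiodic_count_end : aperiodic B -> forall C : nat, exists M,
  forall m i, (M <= m)%N -> (C <= count_end (all_nodes B m) i)%N.
Proof.
move=> ap C.
have countS m i j : (0 < B i j)%N ->
    (count_end (all_nodes B m) j <= count_end (all_nodes B m.+1) i)%N.
  move=> Bij; rewrite count_end_extensions (bigD1 j) //=.
  by rewrite (leq_trans _ (leq_addr _ _)) // leq_pmull.
(* Counts do not decrease along an edge and every vertex has a predecessor, so one level is
   enough. *)
suff [M hM] : exists M, forall i, (C <= count_end (all_nodes B M) i)%N.
  exists M => m i Mm; rewrite -(subnKC Mm).
  elim: (m - M)%N i => [|k IH] i; first by rewrite addn0.
  have [j Bij] := no_zero_row B i.
  by rewrite addnS; exact: leq_trans (IH j) (countS _ _ _ Bij).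
apply: contrapT => /forallNP nM.
pose P (t : node) := is_node (size t.2) t /\
  (count_end (all_nodes B (size t.2)) (node_end t) < C)%N.
have [i s f|m|p hp] := @konig _ B P.
- rewrite /P /= size_rcons is_node_rcons => -[/andP[ns /eqP sf] h]; split=> //.
  apply: leq_ltn_trans (countS _ _ _ _) h.
  rewrite -sf /node_end /= map_rcons last_rcons.
  by case: f {sf} => -[j i'] k; exact: leq_trans (ltn_ord k).
- have /existsNP[i /negP] := nM m; rewrite -ltnNge => hi.
  have := count_end_gt0 B m i; rewrite /count_end -has_count => /hasP[t].
  rewrite mem_all_nodes => tm /eqP te; exists t => //.
  by have /andP[_ /eqP sz] := tm; rewrite /P sz te.
have [F Fsub CF] := infinite_set_fset C (ap p).
have /choice[g hg] : forall q : path_space B, exists N, cofinal p q ->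
    forall k, (N <= k)%N -> p k = q k.
  move=> q; have [[N hN]|nq] := pselect (cofinal p q); first by exists N.
  by exists 0%N => /nq.
(* From index [N] on the chosen paths coincide with [p], so their prefixes of length [N] are
   distinct and end in the same vertex. *)
pose N := (\max_(q <- F) g q)%N.
have FN q : q \in F -> forall k, (N <= k)%N -> q k = p k.
  move=> qF k Nk; rewrite (hg q) //; first exact: Fsub.
  by apply: leq_trans Nk; exact: leq_bigmax_seq.
have := hp N; rewrite /P /= size_mkseq node_end_prefix => -[_].
rewrite ltnNge => /negP; apply; apply: leq_trans CF _.
rewrite /count_end -size_filter -(size_map (prefix_node N)).
apply: uniq_leq_size.
  rewrite map_inj_in_uniq ?fset_uniq // => q q' qF q'F e.
  apply: path_eq => k; have [kN|Nk] := ltnP k N; first exact: prefix_node_eq e _ kN.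
  by rewrite !FN.
move=> _ /mapP[q qF ->]; rewrite mem_filter mem_all_nodes prefix_is_node andbT.
by rewrite node_end_prefix FN.
Qed.

End PathSpace.

(** * Measures of clopen sets and of cylinders *)

Section ClassMeasure.
Variables (K : nat) (B : bratteli K) (R : realType).
Variable mu : {measure set (borel_paths B) -> \bar R}.

Local Notation node := ('I_K.+1 * seq (edge B))%type.

Lemma measurable_paths_through m (l : seq node) :
  measurable (paths_through m l : set (borel_paths B)).
Proof. by apply: sub_sigma_algebra; exact: open_paths_through. Qed.

Lemma measurable_cylinder (e : finite_path B) :
  measurable (cylinder e : set (borel_paths B)).
Proof. by apply: sub_sigma_algebra; exact: open_cylinder. Qed.

Definition in_vertices (D : {set 'I_K.+1}) (m : nat) : set (borel_paths B) :=
  [set p : path_space B | src (p m) \in D].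

Lemma paths_through_in_vertices D m (l : seq node) :
  paths_through m l `&` in_vertices D m =
  paths_through m [seq t <- l | node_end t \in D].
Proof.
apply/seteqP; split=> p; rewrite /in_vertices /paths_through /= mem_filter
  node_end_prefix; first by case=> -> ->.
by case/andP.
Qed.

Lemma in_verticesE D m :
  in_vertices D m = paths_through m [seq t <- all_nodes B m | node_end t \in D].
Proof.
rewrite -paths_through_in_vertices (_ : paths_through m (all_nodes B m) = setT) ?setTI //.
by apply/seteqP; split=> // p _; rewrite /paths_through /= mem_all_nodes prefix_is_node.
Qed.

Lemma measurable_in_vertices D m : measurable (in_vertices D m).
Proof. by rewrite in_verticesE; exact: measurable_paths_through. Qed.

Variables (Vf : {set 'I_K.+1}) (X : 'I_K.+1 -> R) (lambda : R).
Hypothesis mu_cylinder : forall e : finite_path B, fend e \in Vf ->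
  mu (cylinder e) = (X (fend e) / lambda ^+ size (fedges e))%:E.

(** Finite additivity over disjoint cylinders; [D] is later [Vf], the class [alpha], or the rest
    [Vf :\: alpha]. *)
Lemma measure_paths_through (D : {set 'I_K.+1}) m (l : seq node) :
  D \subset Vf -> uniq l ->
  {in l, forall t, is_node m t} -> {in l, forall t, node_end t \in D} ->
  mu (paths_through m l)
  = ((\sum_(i in D) (count_end l i)%:R * X i) / lambda ^+ m)%:E.
Proof.
move=> DV; elim: l => [|t l IH] /=.
  move=> _ _ _; rewrite (_ : paths_through m [::] = set0) ?measure0 -?subset0 //.
  by rewrite big1 ?mul0r // => i _; rewrite mul0r.
move=> /andP[tl ul] ln lD.
rewrite paths_through_cons measureU; try exact: measurable_paths_through; last first.
  rewrite -subset0 => p [/=]; rewrite /paths_through /= inE => /eqP -> tl'.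
  by rewrite tl' in tl.
rewrite [Y in (_ + Y = _)%E]IH //; first last.
- by move=> s sl; apply: lD; rewrite inE sl orbT.
- by move=> s sl; apply: ln; rewrite inE sl orbT.
have tD : node_end t \in D by apply: lD; rewrite inE eqxx.
have [e [e1 e2 e3 ->]] := paths_through1 (ln t (mem_head _ _)).
have et : fend e = node_end t by rewrite /fend e1 e2.
rewrite [Y in (Y + _ = _)%E]mu_cylinder et ?(fintype.subsetP DV) // e3.
rewrite -EFinD -mulrDl; congr (_ / _)%:E.
rewrite (bigD1 (node_end t)) //= [in RHS](bigD1 (node_end t)) //= addrA.
congr (_ + _); last first.
  by apply: eq_bigr => i /andP[_ /negPf]; rewrite eq_sym => ->.
by rewrite eqxx natrD mulrDl mul1r.
Qed.

Variable alpha : {set 'I_K.+1}.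
Hypothesis mu_alpha : mu (~` (@eventually_in K B alpha)) = 0%E.
Hypothesis alpha_closed : forall i j, i \in alpha -> (0 < B j i)%N -> j \in alpha.
Hypothesis alphaVf : alpha \subset Vf.
Hypothesis lambda_gt0 : 0 < lambda.

Lemma in_alpha_nondecreasing : nondecreasing_seq (in_vertices alpha).
Proof.
apply/nondecreasing_seqP => m; apply/subsetPset => p; rewrite /in_vertices /= => pm.
apply: alpha_closed pm _; rewrite -(path_linked p m).
by case: (p m) => -[j i] k; exact: leq_ltn_trans (ltn_ord k).
Qed.

Lemma bigcup_in_alpha : \bigcup_m in_vertices alpha m = @eventually_in K B alpha.
Proof.
apply/seteqP; split=> p /=.
  move=> [m _ pm]; exists m => k mk.
  by have /subsetPset/(_ p pm) := in_alpha_nondecreasing mk.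
by move=> [m pm]; exists m => //; exact: pm.
Qed.

(** Paths that enter [alpha] stay there, and almost all paths enter it. Measures, even infinite
    ones, are thus limits of measures inside [alpha], which can be computed. *)
Lemma cvg_measure_in_alpha (A : set (borel_paths B)) : measurable A ->
  mu (A `&` in_vertices alpha m) @[m --> \oo] --> mu A.
Proof.
move=> mA.
have mE : measurable (@eventually_in K B alpha : set (borel_paths B)).
  rewrite -bigcup_in_alpha.
  by apply: bigcup_measurable => m _; exact: measurable_in_vertices.
have -> : mu A = mu (\bigcup_m (A `&` in_vertices alpha m)).
  rewrite -setI_bigcupr bigcup_in_alpha (measureDI _ mA mE).
  rewrite [Y in (Y + _)%E](_ : _ = 0%E) ?add0e //.
  apply/eqP; rewrite eq_le measure_ge0 andbT -mu_alpha.
  apply: le_measure; try apply: mem_set; [exact: measurableD|exact: measurableC|].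
  by move=> p [].
apply: nondecreasing_cvg_mu.
- by move=> m; apply: measurableI => //; exact: measurable_in_vertices.
- by apply: bigcup_measurable => m _; apply: measurableI => //;
    exact: measurable_in_vertices.
- move=> m n mn; apply/subsetPset; apply: setIS.
  by apply/subsetPset; exact: in_alpha_nondecreasing.
Qed.

Lemma paths_through_iter m k (l : seq node) :
  paths_through (m + k) (iter k (@extensions K B) l) = paths_through m l.
Proof.
elim: k => [|k IH]; first by rewrite addn0.
by rewrite addnS paths_through_extensions.
Qed.

Lemma iter_extensions_uniq k (l : seq node) :
  uniq l -> uniq (iter k (@extensions K B) l).
Proof. by move=> ul; elim: k => //= k; exact: extensions_uniq. Qed.

Lemma iter_extensions_nodes m k (l : seq node) :
  {in l, forall t, is_node m t} ->
  {in iter k (@extensions K B) l, forall t, is_node (m + k) t}.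
Proof.
move=> nl; elim: k => [|k IH]; first by rewrite addn0.
by rewrite addnS; exact: extensions_nodes.
Qed.

Lemma count_end_filter (D : {set 'I_K.+1}) (l : seq node) i : i \in D ->
  count_end [seq t <- l | node_end t \in D] i = count_end l i.
Proof.
move=> iD; rewrite /count_end count_filter; apply: eq_count => t /=.
by case: eqP => // ->; rewrite iD.
Qed.

(** The formula for cylinders is assumed only for ends in [Vf]; for other ends, the part that has
    reached [alpha] after [k] refinements can still be measured by counting. *)
Lemma measure_iter_extensions m k (l : seq node) : uniq l ->
  {in l, forall t, is_node m t} ->
  mu (paths_through m l `&` in_vertices alpha (m + k))
  = ((\sum_(i in alpha) (count_end (iter k (@extensions K B) l) i)%:R * X i)
      / lambda ^+ (m + k))%:E.
Proof.
move=> ul nl; rewrite -(paths_through_iter m k) paths_through_in_vertices.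
rewrite (measure_paths_through alphaVf).
- by congr (_ / _)%:E; apply: eq_bigr => i ia; rewrite count_end_filter.
- by rewrite filter_uniq // iter_extensions_uniq.
- move=> t; rewrite mem_filter => /andP[_]; exact: iter_extensions_nodes.
- by move=> t; rewrite mem_filter => /andP[].
Qed.

(* Up to the factor [lambda ^- m], the measure of a cylinder of level [m.+1]
   depends only on its end vertex: it is the limit of the measures of its
   parts that have entered [alpha], and these are counted by [iter k extensions]. *)
Lemma cylinder_finite_end (e e' : finite_path B) : fend e = fend e' ->
  (mu (cylinder e) < +oo)%E -> (mu (cylinder e') < +oo)%E.
Proof.
move=> ee' fe.
pose t : node := (fstart e, fedges e); pose t' : node := (fstart e', fedges e').
have tt' : node_end t = node_end t' by exact: ee'.
pose m := size (fedges e); pose m' := size (fedges e').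
have tn : {in [:: t], forall t, is_node m t}.
  by move=> _ /[!inE] /eqP ->; rewrite /is_node eqxx andbT /=; case: (e).
have tn' : {in [:: t'], forall t, is_node m' t}.
  by move=> _ /[!inE] /eqP ->; rewrite /is_node eqxx andbT /=; case: (e').
(* Prolongations depend only on the end vertex, which the two cylinders share. *)
have count_tt' k i : count_end (iter k (@extensions K B) [:: t]) i
    = count_end (iter k (@extensions K B) [:: t']) i.
  elim: k i => [|k IH] i /=; first by rewrite /count_end /= tt'.
  by rewrite !count_end_extensions; apply: eq_bigr => j _; rewrite IH.
have [r r0 hr] : exists2 r, 0 <= r & mu (cylinder e) = r%:E.
  exists (fine (mu (cylinder e))); first exact: fine_ge0.
  by rewrite fineK // ge0_fin_numE.
have le k : (mu (cylinder e' `&` in_vertices alpha (m' + k))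
    <= (r * lambda ^+ m / lambda ^+ m')%:E)%E.
  have : (mu (cylinder e `&` in_vertices alpha (m + k)) <= r%:E)%E.
    rewrite -hr; apply: measureIl; first exact: measurable_cylinder.
    exact: measurable_in_vertices.
  rewrite !cylinder_paths_through !measure_iter_extensions // !lee_fin.
  under eq_bigr do rewrite count_tt'.
  rewrite !exprD; move: (\sum_(i in _) _) => C h.
  have m0 : lambda ^+ m != 0 by rewrite expf_neq0 // gt_eqF.
  have -> : C / (lambda ^+ m' * lambda ^+ k)
      = C / (lambda ^+ m * lambda ^+ k) * lambda ^+ m / lambda ^+ m'.
    by rewrite !invfM !mulrA -mulrA [X in _ = X / _]mulrAC mulfVK // mulrA mulrAC.
  by rewrite !ler_wpM2r // ?invr_ge0 exprn_ge0 // ltW.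
have := cvg_measure_in_alpha (measurable_cylinder e').
move/cvge_to_le => /(_ (r * lambda ^+ m / lambda ^+ m')%:E) h.
apply: le_lt_trans (h _) (ltry _).
exists m' => // k /= mk; rewrite -(subnKC mk); exact: le.
Qed.

(** Prolonging the one-vertex path at [j] by an edge gives a subset of a cylinder of finite measure;
    [cylinder_finite_end] carries finiteness over to all cylinders ending in the new vertex. *)
Lemma finite_end_connect j u : connect (@Defs.adjacent K B) j u ->
  (forall e : finite_path B, fend e = j -> (mu (cylinder e) < +oo)%E) ->
  forall e : finite_path B, fend e = u -> (mu (cylinder e) < +oo)%E.
Proof.
move=> /connectP[p + ->]; elim: p j => [//|c p IH] j /= /andP[jc pc] fj.
apply: IH pc _ => e ec.
have : (0 < B (j, c).2 (j, c).1)%N by [].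
move=> /Ordinal f0.
pose f : edge B := Tagged (fun ji : 'I_K.+1 * 'I_K.+1 => 'I_(B ji.2 ji.1)) f0.
have cf : composable j [:: f] by rewrite /= eqxx.
apply: (@cylinder_finite_end (FinitePath cf)); first by rewrite ec.
apply: le_lt_trans (fj (@FinitePath _ B j [::] isT) erefl).
apply: le_measure; try (apply: mem_set; exact: measurable_cylinder).
by move=> p0 [].
Qed.

End ClassMeasure.

(** * The group of values and the action of the incidence matrix on it *)

Section DimensionGroup.
Variables (K : nat) (B : bratteli K) (R : realType).
Variables (X : 'I_K.+1 -> R) (lambda : R).
Hypothesis lambda_gt0 : 0 < lambda.

(** This is [A_D X = lambda X] for [A] the transpose of the incidence matrix, indexed by the
    vertices themselves to avoid renumbering by [enum_val]. *)
Definition eigenvector (D : {set 'I_K.+1}) :=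
  forall i, i \in D -> \sum_(u in D) (B u i)%:R * X u = lambda * X i.

Definition combination (D : {set 'I_K.+1}) (w : 'I_K.+1 -> int) : R :=
  \sum_(i in D) (w i)%:~R * X i.

Definition push (D : {set 'I_K.+1}) (w : 'I_K.+1 -> int) : 'I_K.+1 -> int :=
  fun u => \sum_(i in D) (B u i)%:R * w i.

(** For [D = Vf] this is the union in the theorem, before intersection with the half-line. *)
Definition values_group (D : {set 'I_K.+1}) : set R :=
  [set r | exists N w, r = combination D w / lambda ^+ N].

(** Duality: pairing [F w] with [X] is pairing [w] with [F^T X]. It lets a number be rewritten at
    every higher level. *)
Lemma combination_push D w : eigenvector D ->
  combination D (push D w) = lambda * combination D w.
Proof.
move=> eD; rewrite /combination /push mulr_sumr.
under eq_bigr do rewrite rmorph_sum mulr_suml.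
rewrite exchange_big /=; apply: eq_bigr => i iD.
rewrite mulrCA -eD // mulr_sumr; apply: eq_bigr => u _.
by rewrite rmorphM /= rmorph_nat mulrAC mulrC mulrA.
Qed.

Lemma combination_iter D w k : eigenvector D ->
  combination D (iter k (push D) w) = lambda ^+ k * combination D w.
Proof.
move=> eD; elim: k => [|k IH]; first by rewrite expr0 mul1r.
by rewrite /= combination_push // IH mulrA -exprS.
Qed.

Lemma combination_lift D w N k : eigenvector D ->
  combination D w / lambda ^+ N =
  combination D (iter k (push D) w) / lambda ^+ (N + k).
Proof.
move=> eD; have lk : lambda ^+ k != 0 by rewrite expf_neq0 // gt_eqF.
rewrite combination_iter // exprD invfM [in RHS](mulrC (lambda ^+ k)).
by rewrite mulrACA mulfV // mulr1.
Qed.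

Lemma combinationB D w v :
  combination D (fun i => w i - v i) = combination D w - combination D v.
Proof.
rewrite /combination -sumrB; apply: eq_bigr => i _.
by rewrite rmorphB mulrBl.
Qed.

Lemma push_ge0 (D : {set 'I_K.+1}) w : (forall i, i \in D -> 0 <= w i) ->
  forall i, 0 <= push D w i.
Proof. by move=> w0 i; apply: sumr_ge0 => u uD; rewrite mulr_ge0 ?w0. Qed.

Lemma push_iter_ge0 (D : {set 'I_K.+1}) w k k' : (k <= k')%N ->
  (forall i, i \in D -> 0 <= iter k (push D) w i) ->
  forall i, i \in D -> 0 <= iter k' (push D) w i.
Proof.
move=> kk' h; rewrite -(subnK kk') iterD.
elim: (k' - k)%N => [|n IH] //= i iD; exact: push_ge0.
Qed.

Lemma push_iterB D w v k i :
  iter k (push D) (fun j => w j - v j) i = iter k (push D) w i - iter k (push D) v i.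
Proof.
elim: k i => [//|k IH] i /=; rewrite /push -sumrB; apply: eq_bigr => j _.
by rewrite IH mulrBr.
Qed.

Lemma values_groupP D r N : eigenvector D -> values_group D r ->
  exists2 m, (N <= m)%N & exists w, r = combination D w / lambda ^+ m.
Proof.
move=> eD [n [w ->]]; exists (n + N)%N; first exact: leq_addl.
by exists (iter N (push D) w); exact: combination_lift.
Qed.

Lemma values_group_level D r : eigenvector D -> values_group D r ->
  exists N, forall m, (N <= m)%N -> exists w, r = combination D w / lambda ^+ m.
Proof.
move=> eD [n [w ->]]; exists n => m nm; exists (iter (m - n) (push D) w).
by rewrite {1}(combination_lift w n (m - n) eD) subnKC.
Qed.

Lemma values_group_subgroup D : eigenvector D -> additive_subgroup (values_group D).
Proof.
move=> eD; split.
  apply: mem_set; exists 0%N, (fun=> 0); rewrite /combination big1 ?mul0r // => i _.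
  by rewrite mul0r.
move=> a b /set_mem Ga /set_mem Gb; apply: mem_set.
have [Na ha] := values_group_level eD Ga; have [Nb hb] := values_group_level eD Gb.
have [w ->] := ha (maxn Na Nb) (leq_maxl _ _).
have [v ->] := hb (maxn Na Nb) (leq_maxr _ _).
by exists (maxn Na Nb), (fun i => w i - v i); rewrite combinationB mulrBl.
Qed.

Lemma values_group_lambda D s : eigenvector D ->
  values_group D s -> values_group D (lambda * s).
Proof.
move=> eD [N [w ->]]; exists N, (push D w).
by rewrite combination_push // mulrA.
Qed.

Lemma values_groupV D s k : values_group D s -> values_group D (s / lambda ^+ k).
Proof.
by move=> [N [w ->]]; exists (N + k)%N, w; rewrite exprD invfM mulrA.
Qed.

Lemma values_group_combination D w : values_group D (combination D w).
Proof. by exists 0%N, w; rewrite expr0 divr1. Qed.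

Lemma block_mulmx (D : {set 'I_K.+1}) (i : 'I_#|D|) (x : 'cV[R]_#|D|) :
  (forall j, x j 0 = X (enum_val j)) ->
  (block B R D *m x) i 0 = \sum_(u in D) (B u (enum_val i))%:R * X u.
Proof.
move=> xX; rewrite mxE [RHS]big_enum_val; apply: eq_bigr => j _.
by rewrite !mxE xX.
Qed.

(** [push] is right multiplication of the coefficient row by the block, and [combination] pairs this
    row with a positive eigenvector, so [primitive_mx_eventually_ge0] applies. *)
Lemma primitive_push_ge0 (D : {set 'I_K.+1}) w :
  (forall i, i \in D -> 0 < X i) -> eigenvector D ->
  primitive (block B R D) -> 0 < combination D w ->
  exists k, forall i, i \in D -> 0 <= iter k (push D) w i.
Proof.
move=> X0 eD prim w0.
pose x : 'cV[R]_#|D| := \col_j X (enum_val j).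
pose y : 'rV[R]_#|D| := \row_j (w (enum_val j))%:~R.
have Ax : block B R D *m x = lambda *: x.
  apply/matrixP => i j; rewrite ord1 block_mulmx; last by move=> j'; rewrite mxE.
  by rewrite eD ?enum_valP // !mxE.
have x0 i : 0 < x i 0 by rewrite mxE X0 // enum_valP.
have yx : 0 < (y *m x) 0 0.
  move: w0; rewrite /combination big_enum_val mxE.
  by rewrite (eq_bigr (fun j => y 0 j * x j 0)) // => j _; rewrite !mxE.
have [k hk] := primitive_mx_eventually_ge0 lambda_gt0 prim x0 Ax yx.
exists k => i iD.
have yk j : (y *m block B R D ^+ k) 0 j = (iter k (push D) w (enum_val j))%:~R.
  elim: k {hk} j => [|k IH] j; first by rewrite expr0 mulmx1 mxE.
  rewrite exprSr mulmxA mxE /= /push rmorph_sum [RHS]big_enum_val.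
  by apply: eq_bigr => u _; rewrite IH !mxE rmorphM /= rmorph_nat mulrC.
by have := hk (enum_rank_in iD i); rewrite yk enum_rankK_in // ler0z.
Qed.

End DimensionGroup.

(** * Torsion of the vertices outside [alpha] modulo the group of [alpha] *)

Section Torsion.
Variables (K : nat) (B : bratteli K) (R : realType).
Variables (X : 'I_K.+1 -> R) (lambda : R) (alpha Vf : {set 'I_K.+1}).
Hypothesis lambda_gt0 : 0 < lambda.
Hypothesis alphaVf : alpha \subset Vf.
Hypothesis alpha_closed : forall i j, i \in alpha -> (0 < B j i)%N -> j \in alpha.
Hypothesis Vf_closed : forall i j, i \in Vf -> (0 < B j i)%N -> j \in Vf.
Hypothesis X_gt0 : forall i, i \in Vf -> 0 < X i.
Hypothesis X_eigen : eigenvector B X lambda Vf.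
Hypothesis alpha_reach : forall i, i \in Vf ->
  exists2 a, a \in alpha & connect (@Defs.adjacent K B) i a.

Lemma sum_alpha_split (F : 'I_K.+1 -> R) :
  \sum_(u in Vf) F u = \sum_(u in alpha) F u + \sum_(u in Vf :\: alpha) F u.
Proof.
rewrite (big_setID alpha) /=; congr (_ + _); apply: eq_bigl => u.
by rewrite (finset.setIidPr alphaVf).
Qed.

Lemma eigenvector_alpha : eigenvector B X lambda alpha.
Proof.
move=> i ia; rewrite -X_eigen ?(fintype.subsetP alphaVf) // sum_alpha_split.
rewrite [X in _ = _ + X]big1 ?addr0 // => u; rewrite inE => /andP[ua _].
case: (posnP (B u i)) => [->|Bui]; first by rewrite mul0r.
by rewrite (alpha_closed ia Bui) in ua.
Qed.

(** Read as a row vector, [X] is a left eigenvector of the incidence block on [alpha], a rational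
    matrix. *)
Lemma eigenvalue_algebraic : alpha != finset.set0 ->
  exists2 c : {poly rat}, c != 0 & root (map_poly ratr c) lambda.
Proof.
move=> /set0Pn[a aalpha].
pose F : 'M[rat]_#|alpha| := \matrix_(i, j) (B (enum_val i) (enum_val j))%:R.
exists (char_poly F); first exact: monic_neq0 (char_poly_monic F).
rewrite map_char_poly -eigenvalue_root_char; apply/eigenvalueP.
exists (\row_i X (enum_val i)).
  apply/rowP => i; rewrite !mxE -eigenvector_alpha ?enum_valP // [RHS]big_enum_val.
  by apply: eq_bigr => j _; rewrite !mxE rmorph_nat mulrC.
apply/rV0Pn; exists (enum_rank_in aalpha a).
by rewrite !mxE enum_rankK_in // gt_eqF // X_gt0 // (fintype.subsetP alphaVf).
Qed.

(** On [Vf :\: alpha] the difference [lambda x - A x] collects the edges into [alpha], weighted by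
    [X]; it is nonnegative and in the group of [alpha]. Every vertex reaches [alpha], which excludes
    [lambda] as an eigenvalue of this block, and [integer_multiple_mem] yields [q]. *)
Lemma integer_multiple_values_group : alpha != finset.set0 ->
  exists2 q : nat, (0 < q)%N &
    forall b, b \in Vf :\: alpha -> values_group X lambda alpha (q%:R * X b).
Proof.
move=> alpha0; have [c c0 cl] := eigenvalue_algebraic alpha0.
set D := (Vf :\: alpha)%SET.
pose A : 'M[int]_#|D| := \matrix_(i, j) (B (enum_val j) (enum_val i))%:R.
pose x : 'cV[R]_#|D| := \col_i X (enum_val i).
have DVf i : i \in D -> i \in Vf by rewrite inE => /andP[].
have defect i : (lambda *: x - map_mx intr A *m x) i 0 =
    combination X alpha (fun u => (B u (enum_val i))%:R).
  rewrite !mxE -X_eigen ?DVf ?enum_valP // sum_alpha_split -/D.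
  rewrite [in Y in _ + Y - _]big_enum_val /combination /=.
  under [in RHS]eq_bigr do rewrite rmorph_nat.
  rewrite -addrA [Y in _ + Y](_ : _ = 0) ?addr0 //.
  by rewrite -sumrB big1 // => j _; rewrite !mxE rmorph_nat subrr.
have Apos i j : 0 <= (map_mx intr A : 'M[R]_#|D|) i j by rewrite !mxE rmorph_nat.
have gpos i : 0 <= (lambda *: x - map_mx intr A *m x) i 0.
  rewrite defect; apply: sumr_ge0 => u ua; rewrite rmorph_nat mulr_ge0 //.
  by rewrite ltW // X_gt0 // (fintype.subsetP alphaVf).
have xpos i : 0 < x i 0 by rewrite mxE X_gt0 // DVf // enum_valP.
have det0 : \det (lambda%:M - map_mx intr A) != 0.
  apply: (det_scalar_sub_neq0 lambda_gt0 Apos xpos gpos) => Z Zg ZA.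
  (* Induction along a path to [alpha]: the last vertex before [alpha] has a positive defect, and
     membership in [Z] is passed back along edges. *)
  suff HZ v p : v \in Vf -> path (@Defs.adjacent K B) v p -> last v p \in alpha ->
      forall i, enum_val i = v -> Z i.
    rewrite -subTset => i _; have iV := DVf _ (enum_valP i).
    have [a aa /connectP[p pp al]] := alpha_reach iV.
    by apply: HZ iV pp _ _ erefl; rewrite -al.
  elim: p v => [|v' p IH] v vV /=.
    by move=> _ va i iv; have := enum_valP i; rewrite iv inE va.
  move=> /andP[vv' pp] la i iv; have v'V := Vf_closed vV vv'.
  have [v'a|v'a] := boolP (v' \in alpha).
    apply: Zg; rewrite defect /combination (bigD1 v') //= iv.
    rewrite ltr_pwDl //.
      by rewrite rmorph_nat mulr_gt0 ?X_gt0 // ltr0n.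
    apply: sumr_ge0 => u /andP[ua _]; rewrite rmorph_nat mulr_ge0 //.
    by rewrite ltW // X_gt0 // (fintype.subsetP alphaVf).
  have v'D : v' \in D by rewrite inE v'a.
  apply: (ZA i (enum_rank_in v'D v')).
    by rewrite !mxE rmorph_nat ltr0n enum_rankK_in // iv.
  by apply: IH v'V pp la _ _; rewrite enum_rankK_in.
have [q q0 hq] := integer_multiple_mem
  (values_group_subgroup lambda_gt0 eigenvector_alpha)
  (fun s => values_group_lambda eigenvector_alpha (s := s)) c0 cl det0
  (fun i => eq_ind_r (values_group X lambda alpha)
     (values_group_combination _ _ _ _) (defect i)).
exists q => // b bD.
by have := hq (enum_rank_in bD b); rewrite mxE enum_rankK_in.
Qed.

End Torsion.

(** * The two inclusions for the set of clopen values *)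

Section ClopenValues.
Variables (K : nat) (B : bratteli K) (R : realType).
Variable mu : {measure set (borel_paths B) -> \bar R}.
Variables (X : 'I_K.+1 -> R) (lambda : R) (alpha Vf : {set 'I_K.+1}).
Hypothesis lambda_gt1 : 1 < lambda.
Hypothesis aperiodicB : aperiodic B.
Hypothesis alpha_neq0 : alpha != finset.set0.
Hypothesis alphaVf : alpha \subset Vf.
Hypothesis alpha_closed : forall i j, i \in alpha -> (0 < B j i)%N -> j \in alpha.
Hypothesis Vf_closed : forall i j, i \in Vf -> (0 < B j i)%N -> j \in Vf.
Hypothesis alpha_reach : forall i, i \in Vf ->
  exists2 a, a \in alpha & connect (@Defs.adjacent K B) i a.
Hypothesis alpha_primitive : primitive (block B R alpha).
Hypothesis X_gt0 : forall i, i \in Vf -> 0 < X i.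
Hypothesis X_eigen : eigenvector B X lambda Vf.
Hypothesis mu_cylinder : forall e : finite_path B, fend e \in Vf ->
  mu (cylinder e) = (X (fend e) / lambda ^+ size (fedges e))%:E.
Hypothesis cylinder_Vf : forall e : finite_path B,
  (mu (cylinder e) < +oo)%E -> fend e \in Vf.
Hypothesis mu_alpha : mu (~` (@eventually_in K B alpha)) = 0%E.
Hypothesis mu_infinite : mu setT = +oo%E.

Local Notation node := ('I_K.+1 * seq (edge B))%type.

Let lambda_gt0 : 0 < lambda. Proof. exact: lt_trans lambda_gt1. Qed.

Let alpha_eigen : eigenvector B X lambda alpha.
Proof. exact: eigenvector_alpha alphaVf alpha_closed X_eigen. Qed.

Lemma combinationE (D : {set 'I_K.+1}) (w : 'I_K.+1 -> nat) :
  \sum_(i in D) (w i)%:R * X i = combination X D (fun i => (w i)%:Z).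
Proof. by apply: eq_bigr => i _. Qed.

(** A cylinder inside a set of finite measure has finite measure, so it ends in [Vf], where the
    measure formula applies. *)
Lemma clopen_value_group (U : set (path_space B)) : clopen U ->
  (mu U < +oo)%E -> values_group X lambda Vf (fine (mu U)).
Proof.
move=> /clopenP[m [l [ul nl ->]]] Ufin.
rewrite (measure_paths_through mu_cylinder (fintype.subxx Vf) ul nl).
  by exists m, (fun i => count_end l i); rewrite /= combinationE.
move=> t tl; have [e [e1 e2 e3 eU]] := paths_through1 (nl _ tl).
have <- : fend e = node_end t by rewrite /fend e1 e2.
apply: cylinder_Vf; apply: le_lt_trans Ufin; rewrite -eU.
apply: le_measure; try (apply: mem_set; exact: measurable_paths_through).
by move=> p; rewrite /paths_through /= inE => /eqP ->.
Qed.

Lemma extensions_end_alpha (l : seq node) :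
  {in l, forall t, node_end t \in alpha} ->
  {in extensions l, forall t, node_end t \in alpha}.
Proof.
move=> la _ /allpairsPdep[t [f [tl + ->]]]; rewrite mem_filter => /andP[/eqP tf _].
rewrite /node_end map_rcons last_rcons; apply: alpha_closed (la _ tl) _.
rewrite -tf; case: f {tf} => -[j i] k; exact: leq_ltn_trans (ltn_ord k).
Qed.

Lemma count_end_notin (l : seq node) i :
  {in l, forall t, node_end t \in alpha} -> i \notin alpha -> count_end l i = 0%N.
Proof.
move=> la ia; apply/eqP; rewrite -leqn0 leqNgt -has_count; apply/hasP => -[t tl].
by move=> /eqP e; move: ia; rewrite -e la.
Qed.

(** No edge leaves [alpha], so [push] restricted to [alpha] counts all prolongations. *)
Lemma count_end_push k (l : seq node) i :
  {in l, forall t, node_end t \in alpha} ->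
  (count_end (iter k (@extensions K B) l) i)%:Z
  = iter k (push B alpha) (fun j => (count_end l j)%:Z) i.
Proof.
move=> la; elim: k i => [//|k IH] i.
have lak : {in iter k (@extensions K B) l, forall t, node_end t \in alpha}.
  by elim: k {IH} => //= k IH; exact: extensions_end_alpha.
rewrite /= count_end_extensions /push -natz natr_sum (bigID (mem alpha)) /=.
rewrite [Y in _ + Y]big1 ?addr0 => [|j ja]; last by rewrite count_end_notin // muln0.
by apply: eq_bigr => j _; rewrite natrM -IH; congr (_ * _); exact: natz.
Qed.

Lemma select_nodes (l : seq node) (D : {set 'I_K.+1}) (w : 'I_K.+1 -> nat) :
  (forall i, i \in D -> (w i <= count_end l i)%N) ->
  exists l', [/\ subseq l' l, {in l', forall t, node_end t \in D} &
    forall i, i \in D -> count_end l' i = w i].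
Proof.
move=> wl.
(* Demand zero outside [D] keeps other end vertices out of the selection. *)
have [i|l' sl cl] := @subseq_count _ _ (@node_end K B) l
    (fun i => if i \in D then w i else 0%N).
  by case: ifP => // /wl.
exists l'; split=> // [t tl|i iD]; last by rewrite /count_end cl iD.
apply: contraT => tD; have := cl (node_end t); rewrite (negPf tD) => /eqP.
by rewrite -leqn0 leqNgt -has_count => /hasP[]; exists t.
Qed.

(** The infinite total mass enters here: the measures of these sets tend to [mu setT]. *)
Lemma in_alpha_unbounded (r : R) :
  exists M, forall m, (M <= m)%N -> (r%:E < mu (in_vertices alpha m))%E.
Proof.
have := cvg_measure_in_alpha mu_alpha alpha_closed (@measurableT _ (borel_paths B)).
rewrite mu_infinite => /cvgeyPgt/(_ r)[M _ hM]; exists M => m Mm.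
by have := hM m Mm; rewrite /= setTI.
Qed.

Lemma lambda_small (b a : R) : 0 <= b -> 0 < a ->
  exists M, forall m, (M <= m)%N -> b / lambda ^+ m <= a.
Proof.
move=> b0 a0; have [|M hM] := @geometric_small R lambda^-1 b a _ a0.
  by rewrite invr_ge0 ltW //= invf_lt1.
exists M => m Mm; apply: le_trans hM; rewrite mulrC ler_wpM2r // exprVn.
by rewrite lef_pV2 ?posrE ?exprn_gt0 // ler_weXn2l // ltW.
Qed.

(** With [Y] the set [in_vertices alpha m], both [r] and [mu Y - r] are positive. Once the
    coefficients of both are nonnegative, the number of cylinders demanded at each vertex lies
    between zero and the number available in [Y]. *)
Lemma subset_clopen_value m (r : R) : values_group X lambda alpha r -> 0 < r ->
  (r%:E < mu (in_vertices alpha m))%E ->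
  exists U : set (path_space B), [/\ clopen U, U `<=` in_vertices alpha m & mu U = r%:E].
Proof.
move=> rG r0 rmu.
have [L mL [v rE]] := values_groupP lambda_gt0 m alpha_eigen rG.
pose l := [seq t <- all_nodes B m | node_end t \in alpha].
have ul : uniq l by rewrite filter_uniq // all_nodes_uniq.
have nl : {in l, forall t, is_node m t}.
  by move=> t; rewrite mem_filter mem_all_nodes => /andP[].
have la : {in l, forall t, node_end t \in alpha}.
  by move=> t; rewrite mem_filter => /andP[].
pose lk k := iter k (@extensions K B) l.
have lka k : {in lk k, forall t, node_end t \in alpha}.
  by rewrite /lk; elim: k => //= k IH; exact: extensions_end_alpha.
have lkn k := iter_extensions_nodes (k := k) nl.
have lku k : uniq (lk k) by exact: iter_extensions_uniq.
pose d := (L - m)%N; have mdL : (m + d)%N = L by rewrite subnKC.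
pose c := fun j => (count_end (lk d) j)%:Z.
have lL : 0 < lambda ^+ L by rewrite exprn_gt0.
have muE : mu (in_vertices alpha m) = (combination X alpha c / lambda ^+ L)%:E.
  rewrite in_verticesE -(paths_through_iter m d).
  rewrite (measure_paths_through mu_cylinder alphaVf (lku _) (lkn _) (lka _)).
  by rewrite mdL combinationE.
have v0 : 0 < combination X alpha v.
  by move: r0; rewrite rE pmulr_lgt0 // invr_gt0.
have cv0 : 0 < combination X alpha (fun j => c j - v j).
  by move: rmu; rewrite muE rE lte_fin ltr_pM2r ?invr_gt0 // combinationB subr_gt0.
have Xa i : i \in alpha -> 0 < X i by move/(fintype.subsetP alphaVf); exact: X_gt0.
have [k1 h1] := primitive_push_ge0 lambda_gt0 Xa alpha_eigen alpha_primitive v0.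
have [k2 h2] := primitive_push_ge0 lambda_gt0 Xa alpha_eigen alpha_primitive cv0.
(* This exponent serves both coefficient vectors, since nonnegativity persists under [push]. *)
pose k := (k1 + k2)%N.
have {}h1 := push_iter_ge0 (leq_addr k2 k1) h1.
have {}h2 := push_iter_ge0 (leq_addl k1 k2) h2.
pose w := iter k (push B alpha) v.
have cE i : iter k (push B alpha) c i = (count_end (lk (d + k)%N) i)%:Z.
  by rewrite -count_end_push // -iterD addnC.
have wle i : i \in alpha -> (`|w i| <= count_end (lk (d + k)%N) i)%N.
  move=> ia; have := h2 i ia; rewrite push_iterB cE subr_ge0 -/(w i).
  by rewrite -[w i](gez0_abs (h1 i ia : 0 <= w i)).
have [l' [sl' l'a l'w]] := select_nodes wle.
exists (paths_through (m + (d + k)) l'); split.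
- exact: clopen_paths_through.
- rewrite in_verticesE -(paths_through_iter m (d + k)).
  by move=> p; rewrite /paths_through /=; exact: mem_subseq.
- rewrite (measure_paths_through mu_cylinder alphaVf (subseq_uniq sl' (lku _))) //.
    rewrite addnA mdL rE (combination_lift lambda_gt0 v L k alpha_eigen).
    congr (_ / _)%:E; apply: eq_bigr => i ia.
    by rewrite l'w // -[in RHS](gez0_abs (h1 i ia)) -pmulrn.
  by move=> t /(mem_subseq sl'); exact: lkn.
Qed.

(* Negative coefficients at vertices outside [alpha] are removed by reducing
   them modulo a common [q] with [q X_b] in the group of [alpha]; the finitely
   many cylinders needed there exist at high levels because of aperiodicity. *)
Lemma group_value_clopen (r : R) : values_group X lambda Vf r -> 0 < r ->
  exists2 U : set (path_space B), clopen U & mu U = r%:E.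
Proof.
move=> rG r0.
have [q q0 hq] := integer_multiple_values_group lambda_gt0 alphaVf alpha_closed
  Vf_closed X_gt0 X_eigen alpha_reach alpha_neq0.
set D := (Vf :\: alpha)%SET in hq *.
have DVf : D \subset Vf by exact: subsetDl.
have XD i : i \in D -> 0 < X i by move/(fintype.subsetP DVf); exact: X_gt0.
have [M0 hM0] := values_group_level lambda_gt0 X_eigen rG.
have [M1 hM1] := aperiodic_count_end aperiodicB q.
have [M2 hM2] := in_alpha_unbounded r.
have S0 : 0 <= q%:R * \sum_(i in D) X i.
  by rewrite mulr_ge0 // sumr_ge0 // => i /XD /ltW.
have r2 : 0 < r / 2 by rewrite divr_gt0.
have [M3 hM3] := lambda_small S0 r2.
(* [M0] allows [r] to be represented at this level, [M1] provides [q] cylinders per vertex, [M2]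
   makes the part inside [alpha] larger than [r], and [M3] keeps the contribution of the remainders
   at most [r / 2]. *)
pose m := maxn (maxn M0 M1) (maxn M2 M3).
have /hM0[w rE] : (M0 <= m)%N by rewrite /m !leq_max leqnn.
have {}hM1 i : (q <= count_end (all_nodes B m) i)%N.
  by apply: hM1; rewrite /m !leq_max leqnn orbT.
have {}hM2 : (r%:E < mu (in_vertices alpha m))%E.
  by apply: hM2; rewrite /m !leq_max leqnn !orbT.
have {}hM3 : q%:R * (\sum_(i in D) X i) / lambda ^+ m <= r / 2.
  by apply: hM3; rewrite /m !leq_max leqnn !orbT.
pose n i : nat := `|(w i %% q%:Z)%Z|%N.
have q0' : q%:Z != 0 by rewrite -lt0n.
have nE i : (n i)%:Z = (w i %% q%:Z)%Z by rewrite gez0_abs // modz_ge0.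
have nq i : (n i < q)%N by rewrite -ltz_nat nE ltz_mod.
pose s := (\sum_(i in D) (n i)%:R * X i) / lambda ^+ m.
have lm : 0 < lambda ^+ m by rewrite exprn_gt0.
have sr : s <= r / 2.
  apply: le_trans hM3; rewrite ler_pM2r ?invr_gt0 // mulr_sumr.
  by apply: ler_sum => i /XD iD; rewrite ler_pM2r // ler_nat ltnW.
have s0 : 0 <= s.
  by rewrite divr_ge0 ?(ltW lm) // sumr_ge0 // => i /XD /ltW iD; rewrite mulr_ge0.
have subG := values_group_subgroup lambda_gt0 alpha_eigen.
(* Replacing [w i] by its remainder changes it by a multiple of [q], and [q * X i] is in the group
   of [alpha]. *)
have rsG : values_group X lambda alpha (r - s).
  have -> : r - s = (combination X alpha w +
      \sum_(i in D) (w i %/ q%:Z)%Z%:~R * (q%:R * X i)) / lambda ^+ m.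
    rewrite rE /combination (sum_alpha_split alphaVf) -/D -mulrBl -addrA -sumrB.
    congr ((_ + _) / _); apply: eq_bigr => i _.
    rewrite -mulrBl mulrA; congr (_ * _); rewrite {1}(divz_eq (w i) q%:Z) -nE.
    by rewrite rmorphD rmorphM /= addrK.
  apply: values_groupV; apply: subgroupD => //; first exact: values_group_combination.
  by apply: subgroup_sum => // i iD; apply: subgroupMz => //; exact: hq.
have rs0 : 0 < r - s by lra.
have [|U2 [cU2 U2sub muU2]] := subset_clopen_value (m := m) rsG rs0.
  by apply: le_lt_trans hM2; rewrite lee_fin; lra.
have nle i : i \in D -> (n i <= count_end (all_nodes B m) i)%N.
  by move=> _; rewrite (leq_trans (ltnW (nq i))).
have [l [sl lD ln]] := select_nodes nle.
have muU1 : mu (paths_through m l) = s%:E.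
  rewrite (measure_paths_through mu_cylinder DVf (subseq_uniq sl (all_nodes_uniq _ _))) //.
    by congr (_ / _)%:E; apply: eq_bigr => i iD; rewrite ln.
  by move=> t /(mem_subseq sl); rewrite mem_all_nodes.
exists (paths_through m l `|` U2); first exact: clopenU (clopen_paths_through _ _) cU2.
rewrite measureU.
- by rewrite [Y in (Y + _)%E]muU1 [Y in (_ + Y)%E]muU2 -EFinD addrC subrK.
- exact: measurable_paths_through.
- by apply: sub_sigma_algebra; case: cU2.
(* At the same level, paths of [U2] are in [alpha] while the chosen cylinders end outside it. *)
- rewrite -subset0 => p [/= pl /U2sub]; rewrite /in_vertices /= -node_end_prefix => pa.
  by have := lD _ pl; rewrite inE pa.
Qed.

End ClopenValues.

(** * The group-like property *)

Section GroupLike.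
Variables (K : nat) (B : bratteli K) (R : realType).
Variables (X : 'I_K.+1 -> R) (lambda : R) (D : {set 'I_K.+1}).
Hypothesis lambda_gt1 : 1 < lambda.
Hypothesis D_neq0 : D != finset.set0.
Hypothesis X_gt0 : forall i, i \in D -> 0 < X i.
Hypothesis X_eigen : eigenvector B X lambda D.

Let lambda_gt0 : 0 < lambda. Proof. exact: lt_trans lambda_gt1. Qed.

Lemma values_group_small (e : R) : 0 < e ->
  exists2 s, values_group X lambda D s & 0 < s <= e.
Proof.
move=> e0; have /set0Pn[i iD] := D_neq0.
have [M hM] := lambda_small lambda_gt1 (ltW (X_gt0 iD)) e0.
exists (X i / lambda ^+ M); last by rewrite divr_gt0 ?X_gt0 ?exprn_gt0 //= hM.
apply: values_groupV; exists 0%N, (fun j => (j == i)%:Z).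
rewrite expr0 divr1 /combination (bigD1 i) //= eqxx mul1r big1 ?addr0 //.
by move=> j /andP[_ /negPf ->]; rewrite mul0r.
Qed.

Lemma values_group_countable : countable (values_group X lambda D).
Proof.
(* The coefficients enter as a finite function, whose type is countable. *)
pose f (u : nat * {ffun 'I_K.+1 -> int}) := combination X D u.2 / lambda ^+ u.1.
apply: (@sub_countable _ _ _ (f @` setT)); last first.
  by apply: (sub_countable (card_image_le f setT)); exact: countableP.
apply: subset_card_le => r [N [w ->]]; exists (N, finfun w) => //.
by rewrite /f /combination /=; under eq_bigr do rewrite ffunE.
Qed.

(** A single group serves for every [gamma]. Density comes from multiples of arbitrarily small
    positive elements, unboundedness from multiples of one of them. *)
Lemma group_like_values_group :
  group_like (values_group X lambda D `&` [set r | 0 <= r]).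
Proof.
have subG := values_group_subgroup lambda_gt0 X_eigen.
have Gn n s : values_group X lambda D s -> values_group X lambda D (n%:R * s).
  by move=> sG; have := subgroupMz subG n sG; rewrite -pmulrn.
split.
- by move=> r [_ r0]; rewrite /= in_itv /= andbT.
- move=> t; rewrite /= in_itv /= andbT => t0 U /nbhs_ballP[e /= e0 eU].
  (* With [s <= e / 2], the largest multiple of [s] not above [t] is within [e] of it. *)
  have [s sG /andP[s0 se]] := values_group_small (divr_gt0 e0 (ltr0Sn _ 1)).
  have /truncn_itv/andP[n1 n2] : 0 <= t / s by rewrite divr_ge0 // ltW.
  move: (Num.Def.trunc _) n1 n2 => n.
  rewrite ler_pdivlMr // ltr_pdivrMr // -natr1 mulrDl mul1r => n1 n2.
  exists (n%:R * s); split.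
    by split; [exact: Gn|rewrite /= mulr_ge0 // ltW].
  by apply: eU; rewrite /ball /= ger0_norm; lra.
- by apply: sub_countable values_group_countable; apply: subset_card_le => r [].
- move=> [u uu]; have [s sG /andP[s0 _]] := values_group_small (@ltr01 R).
  have u0 : 0 <= u by apply: uu; split=> //=; exact: subgroup0.
  have /truncn_itv/andP[_] : 0 <= u / s by rewrite divr_ge0 // ltW.
  rewrite ltr_pdivrMr // ltNge => /negP; apply; apply: uu; split; first exact: Gn.
  by rewrite /= mulr_ge0 // ltW.
- move=> g _; exists (values_group X lambda D) => //.
  apply/seteqP; split=> r /=; rewrite in_itv /=; first by case=> -[].
  by case=> rG /andP[r0 rg]; rewrite r0 rg.
Qed.

End GroupLike.

(** * From the reduced vector to the groups of values *)

Lemma smallest_subgroup_combination (K : nat) (R : realType) (D : {set 'I_K.+1})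
    (x : 'cV[R]_#|D|) (X : 'I_K.+1 -> R) : (forall i, X (enum_val i) = x i 0) ->
  smallest (@additive_subgroup R) (range (fun i => x i 0))
  = range (combination X D).
Proof.
move=> Xx; apply/seteqP; split=> [h hh|_ [w _ <-] G [subG xG]].
  apply: hh; split.
    split.
      apply: mem_set; exists (fun=> 0) => //; rewrite /combination big1 // => i _.
      by rewrite mul0r.
    move=> a b /set_mem[w _ <-] /set_mem[v _ <-]; apply: mem_set.
    by exists (fun i => w i - v i) => //; rewrite combinationB.
  move=> _ [i _ <-]; exists (fun j => (j == enum_val i)%:Z) => //.
  rewrite /combination (bigD1 (enum_val i)) ?enum_valP //= eqxx mul1r Xx.
  by rewrite big1 ?addr0 // => j /andP[_ /negPf ->]; rewrite mul0r.
apply: subgroup_sum => // i iD; apply: subgroupMz => //.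
by apply: xG; exists (enum_rank_in iD i) => //; rewrite -Xx enum_rankK_in.
Qed.

Theorem theorem3p1 (R : realType) (K : nat) (B : bratteli K)
    (alpha : {set 'I_K.+1}) (lambda : R)
    (mu : {measure set (borel_paths B) -> \bar R})
    (x : 'cV[R]_#|finite_vertices mu alpha|) :
  (* standing assumptions on the diagram *)
  aperiodic B ->
  (forall beta, beta \in vertex_classes B ->
     block B R beta != 0 -> primitive (block B R beta)) ->
  alpha \in vertex_classes B ->
  (forall i, i \in alpha \/
     exists beta, [/\ beta \in vertex_classes B, prec B beta alpha & i \in beta]) ->
  (* lambda is a non-distinguished eigenvalue *)
  lambda = spectral_radius (block B R alpha) ->
  1 < lambda ->
  ~ distinguished B alpha lambda ->
  (* mu is the infinite ergodic invariant measure defined by lambda *)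
  class_measure mu alpha lambda ->
  ergodic mu ->
  mu setT = +oo%E ->
  (* x is the reduced vector, and mu is normalized accordingly *)
  (forall i, 0 < x i 0) ->
  block B R (finite_vertices mu alpha) *m x = lambda *: x ->
  \sum_i x i 0 = 1 ->
  (forall (e : finite_path B) (i : 'I_#|finite_vertices mu alpha|),
     fend e = enum_val i ->
     mu (cylinder e) = (x i 0 / lambda ^+ (level e).-1)%:E) ->
  let H := smallest (@additive_subgroup R) (range (fun i => x i 0)) in
  group_like (clopen_values mu) /\
  clopen_values mu =
    (\bigcup_(N in [set: nat]) [set (lambda ^+ N)^-1 * h | h in H])
    `&` [set r | 0 <= r].
Proof.
move=> aper prim alphaC below _ lambda_gt1 _ [_ mu_alpha _] _ mu_inf x_gt0 Ax _ mu_x H.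
have lambda_gt0 : 0 < lambda by exact: lt_trans lambda_gt1.
set Vf := finite_vertices mu alpha in x x_gt0 Ax mu_x H *.
(* [X] extends the reduced vector by zero to all vertices; on [Vf] the sum has exactly one term. *)
pose X v := \sum_(i | enum_val i == v) x i 0.
have Xx i : X (enum_val i) = x i 0.
  by rewrite /X (big_pred1 i) // => j; rewrite (inj_eq enum_val_inj).
have XE v (vV : v \in Vf) : X v = x (enum_rank_in vV v) 0.
  by rewrite -Xx enum_rankK_in.
have X_gt0 v : v \in Vf -> 0 < X v by move=> vV; rewrite (XE _ vV).
have alphaVf : alpha \subset Vf by exact: finset.subsetUl.
have X_eigen : eigenvector B X lambda Vf.
  move=> v vV; have /matrixP/(_ (enum_rank_in vV v) 0) := Ax.
  by rewrite (@block_mulmx K B R X _ _ _ (fun j => esym (Xx j))) mxE -XE enum_rankK_in.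
have mu_cylinder (e : finite_path B) : fend e \in Vf ->
    mu (cylinder e) = (X (fend e) / lambda ^+ size (fedges e))%:E.
  by move=> eV; rewrite (mu_x e (enum_rank_in eV (fend e))) ?enum_rankK_in // -XE.
have [i0 alphaE] : exists i0, alpha = scc B i0.
  by case/imsetP: alphaC => i0 _ ->; exists i0.
have alpha_i0 : i0 \in alpha by rewrite alphaE inE connect0.
have alpha_neq0 : alpha != finset.set0 by apply/set0Pn; exists i0.
(* Every vertex leads back to [i0], so a successor of a vertex of [alpha] is again in [alpha]. *)
have to_i0 v : connect (@Defs.adjacent K B) v i0.
  have toal a : a \in alpha -> connect (@Defs.adjacent K B) a i0.
    by rewrite alphaE inE => /andP[].
  have [/toal //|[beta [/imsetP[k _ ->] /andP[_] /existsP[j] /andP[jb]]]] := below v.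
  move=> /existsP[a] /andP[aal ja] vb; apply: connect_trans (toal a aal).
  apply: connect_trans ja; move: jb vb; rewrite !inE => /andP[kj _] /andP[_ vk].
  exact: connect_trans vk kj.
have alpha_closed i j : i \in alpha -> (0 < B j i)%N -> j \in alpha.
  rewrite alphaE !inE => /andP[i0i _] Bji; rewrite to_i0 andbT.
  exact: connect_trans i0i (connect1 Bji).
(* If the end is outside [alpha], it lies in a class below; finiteness spreads over that class by
   strong connectedness, so the class belongs to the finite subdiagram. *)
have cylinder_Vf (e : finite_path B) : (mu (cylinder e) < +oo)%E -> fend e \in Vf.
  move=> efin; have [ea|[beta [bC ba eb]]] := below (fend e).
    exact: (fintype.subsetP alphaVf).
  rewrite inE; apply/orP; right; apply/finset.bigcupP; exists beta => //.
  rewrite bC ba; apply/asboolP => e' e'b.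
  apply: (finite_end_connect mu_cylinder mu_alpha alpha_closed alphaVf lambda_gt0
    (j := fend e) (u := fend e')) => // [|e1 e1e]; last first.
    exact: (cylinder_finite_end mu_cylinder mu_alpha alpha_closed alphaVf
      lambda_gt0 (esym e1e) efin).
  move: bC eb e'b => /imsetP[k _ ->]; rewrite !inE => /andP[_ ek] /andP[ke' _].
  exact: connect_trans ek ke'.
have Vf_closed i j : i \in Vf -> (0 < B j i)%N -> j \in Vf.
  move=> iV Bji; apply: (cylinder_Vf (@FinitePath _ B j [::] isT)).
  apply: (finite_end_connect mu_cylinder mu_alpha alpha_closed alphaVf lambda_gt0
    (connect1 Bji)) => // e ei.
  by rewrite mu_cylinder ?ei // ltry.
have alpha_prim : primitive (block B R alpha).
  (* A zero block would make the positive number [lambda * X i0] vanish. *)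
  apply: prim => //; apply/eqP => A0.
  have := @block_mulmx K B R X _ (enum_rank_in alpha_i0 i0) _
    (fun j => mxE matrix_key (fun j (_ : 'I_1) => X (enum_val j)) j 0).
  rewrite A0 mul0mx mxE enum_rankK_in //.
  rewrite (eigenvector_alpha alphaVf alpha_closed X_eigen) // => /esym/eqP.
  by rewrite mulf_eq0 !gt_eqF // X_gt0 // (fintype.subsetP alphaVf).
have valuesE : clopen_values mu = values_group X lambda Vf `&` [set r | 0 <= r].
  apply/seteqP; split=> [_ [U [cU Ufin] <-]|r [rG /=]].
    split; last exact: fine_ge0.
    exact: (clopen_value_group mu_cylinder).
  rewrite le_eqVlt => /predU1P[<-|r0].
    exists set0; last by rewrite measure0.
    by split; [split; [exact: open0|exact: closed0]|rewrite measure0].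
  have [|U cU muU] := group_value_clopen lambda_gt1 aper alpha_neq0 alphaVf
    alpha_closed Vf_closed _ alpha_prim X_gt0 X_eigen mu_cylinder mu_alpha mu_inf rG r0.
    by move=> v _; exists i0.
  by exists U; rewrite ?muU //; split=> //; rewrite muU ltry.
have groupE : values_group X lambda Vf =
    \bigcup_(N in [set: nat]) [set (lambda ^+ N)^-1 * h | h in H].
  rewrite /H (smallest_subgroup_combination Xx).
  apply/seteqP; split=> r.
    by move=> [N [w ->]]; exists N => //; exists (combination X Vf w); rewrite // mulrC.
  by move=> [N _ [_ [w _ <-] <-]]; exists N, w; rewrite mulrC.
rewrite -groupE valuesE; split=> //.
apply: (group_like_values_group lambda_gt1 _ X_gt0 X_eigen).
by apply/set0Pn; exists i0; exact: (fintype.subsetP alphaVf).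
Qed.
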